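(* (a) For every $r\ge 3$ and every antichain $\mathcal{A}\subseteq 2^{[n]}$, the number $\gamma^r_{0,n}(\mathcal{A})$ of $r$-tuples $A_1,A_2,\dots,A_r$ of members of $\mathcal{A}$ with $|\bigcap_{i=1}^rA_i|=0$ and $\bigcup_{i=1}^rA_i=[n]$ is at most $$n^{2r}\,\gamma^r_{0,n}\left(\binom{[n]}{\lfloor n/2\rfloor}\right).$$ If $r=2$ and $n$ is even, then $\gamma^2_{0,n}(\mathcal{A})\le\gamma^2_{0,n}\left(\binom{[n]}{n/2}\right)$, while if $r=2$ and $n$ is odd, then $\gamma^2_{0,n}(\mathcal{A})\le\binom{n-1}{\lfloor n/2\rfloor-1}$. (b) For every $r$ there exists a sequence $l_n$ such that if $\mathcal{A}\subseteq 2^{[n]}$ is an antichain, then the number $\beta^r_0(\mathcal{A})$ of $r$-tuples $A_1,A_2,\dots,A_r$ of members of $\mathcal{A}$ with $|\bigcap_{i=1}^rA_i|=0$ is at most $$n^{2r+1}\beta^r_0\left(\binom{[n]}{l_n}\right).$$ (c) If $\mathcal{A}\subseteq 2^{[n]}$ is an antichain, then $$\beta^2_0(\mathcal{A})\le\frac12\binom{n}{\lfloor n/3\rfloor}\binom{\lceil 2n/3\rceil}{\lfloor n/3\rfloor},$$ and this is sharp, as shown by $\binom{[n]}{\lfloor n/3\rfloor}$ if $n\equiv 0,1\pmod 3$ and by $\binom{[n]}{\lceil n/3\rceil}$ if $n\equiv 2\pmod 3$.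
   Context: $[n]=\{1,\dots,n\}$, $2^{[n]}$ is the family of all subsets of $[n]$, and $\binom{[n]}{k}$ denotes the family of all $k$-element subsets of $[n]$. An antichain is a family of sets no one of which is properly contained in another. For a family $\mathcal{A}\subseteq 2^{[n]}$: $\gamma^r_{0,n}(\mathcal{A})$ is the number of unordered $r$-tuples $\{A_1,\dots,A_r\}$ of $r$ different members of $\mathcal{A}$ with $\bigcap_{i=1}^rA_i=\emptyset$ and $\bigcup_{i=1}^rA_i=[n]$; $\beta^r_0(\mathcal{A})$ is the number of unordered $r$-tuples $\{A_1,\dots,A_r\}$ of $r$ different members of $\mathcal{A}$ with $\bigcap_{i=1}^rA_i=\emptyset$.
   Formalization: In (c), for n≡2 (mod 3) the last lower index ⌊n/3⌋ of the bound is replaced by ⌈n/3⌉, since the printed bound fails (e.g. n=2, {{1},{2}}); sharpness for n≡0,1 (mod 3) is stated for n≥2, as it fails at n=1. (b) is stated for n≥1. *)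

(* Defs.v *)
From mathcomp Require Import all_boot all_order all_algebra.

Set Implicit Arguments.
Unset Strict Implicit.
Unset Printing Implicit Defensive.

Import GRing.Theory Num.Theory.

(* [n] is represented by 'I_n, and a family of subsets of [n] by a term of
   type {set {set 'I_n}}. *)

Definition antichain (n : nat) (F : {set {set 'I_n}}) : Prop :=
  {in F &, forall B C : {set 'I_n}, ~~ (B \proper C)}.

Definition layer (n k : nat) : {set {set 'I_n}} :=
  [set B : {set 'I_n} | #|B| == k].

(* An unordered r-tuple of different members of F is an r-element subfamily
   T of F. *)

Definition gamma0 (r n : nat) (F : {set {set 'I_n}}) : nat :=
  #|[set T : {set {set 'I_n}} |
      [&& T \subset F, #|T| == r,
          \bigcap_(B in T) B == set0 & \bigcup_(B in T) B == setT]]|.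

Definition beta0 (r n : nat) (F : {set {set 'I_n}}) : nat :=
  #|[set T : {set {set 'I_n}} |
      [&& T \subset F, #|T| == r & \bigcap_(B in T) B == set0]]|.

Definition ceil_divn (m d : nat) : nat := (m + d.-1) %/ d.

(* The binomial coefficient with an integer lower index, zero when that index
   is negative; with truncated subtraction 'C(0, 0 - 1) would be 1. *)
Definition binz (n : nat) (k : int) : nat :=
  if k is Posz j then 'C(n, j) else 0.

(* The product of binomials is the largest trinomial coefficient of n.  When
   n = 3m + 2 its parts are m, m + 1 and m + 1: after choosing the part of
   size floor(n/3) = m, one splits the other 2m + 2 points into two halves, so
   the lower index of the second factor has to be ceil(n/3).  With floor(n/3)
   there the bound fails: the layer of 2-sets of [5] has 15 disjoint pairs,
   but 'C(5, 1) * 'C(4, 1) / 2 = 10. *)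
Definition disjoint_pairs_bound (n : nat) : rat :=
  (2^-1 * 'C(n, (n %/ 3)%N)%:R *
   'C(ceil_divn (2 * n)%N 3,
      if (n %% 3 == 2)%N then ceil_divn n 3 else (n %/ 3)%N)%:R)%R.

(* Main.v *)
Require Import Defs.
From mathcomp Require Import all_boot all_order all_algebra fingroup perm zify.

(* Two counts are compared with the number of all maps from [n] to the types
   of points, a point x being of type {i | x in A_i}: r-tuples with empty
   intersection and full union correspond to maps into the 2^r - 2 proper
   nonempty types, those with empty intersection to maps into the 2^r - 1
   proper ones.

   (a), r >= 3.  (2^r - 2)^n bounds the ordered tuples of any family.
   Conversely, cut [n] into two halves: two partial tuples with the same sizes,
   the second one complemented, glue to a tuple in the middle layer, so by
   Cauchy-Schwarz such tuples, repetitions allowed, number at least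
   (2^r - 2)^n / (n/2 + 1)^r; for odd n three further points carrying singletons
   are added.  As the property is inherited by larger families, averaging over
   permutations of the layer shows that excluding repetitions costs at most a
   factor N^r / (N)_r <= 3^r, where N is the size of the layer; if r > N there
   are no tuples by Sperner.

   (a), r = 2.  Pairs are complementary, and Sperner settles even n.  For odd n
   let a random cyclic order act: arcs of a complement-closed antichain have
   pairwise crossing endpoints, so there are at most |A| complementary pairs if
   A is one of the arcs, whence an inequality of Bollobas type.

   (b), r >= 3.  If n <= 2^r - 2, then (2^r - 1)^n <= 3 (2^r - 2)^n and the
   middle layer works as in (a).  Otherwise fix the sizes of the sets; moving
   points from a larger set to a smaller one keeps the intersection empty and
   does not decrease the number of tuples, so almost equal sizes are the worst,
   and deleting one point from at most r - 1 sets makes them equal.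

   (c)  Fixing A, Sperner bounds the members disjoint from A by
   C(n - |A|, (n - |A|)/2); with the LYM inequality this leaves the largest
   trinomial coefficient. *)

Set Implicit Arguments.
Unset Strict Implicit.
Unset Printing Implicit Defensive.

Import Order.TTheory GRing.Theory Num.Theory.

(** * Permutations of a finite set, the LYM inequality and Sperner's theorem *)

(** The quotient x!/(q+1)^x changes by the factor (x+1)/(q+1) at each step, so it is least at x = q.
    Multiplied over parts with a fixed sum, this shows that balanced parts minimise a product of
    factorials. *)
Lemma fact_line q x : q`! * q.+1 ^ x <= x`! * q.+1 ^ q.
Proof.
have up d : q`! * q.+1 ^ (q + d) <= (q + d)`! * q.+1 ^ q.
  elim: d => [|d IHd]; first by rewrite addn0.
  rewrite addnS factS expnS mulnCA -mulnA.
  by apply: leq_mul => //; rewrite ltnS leq_addr.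
have down d : d <= q -> q`! * q.+1 ^ (q - d) <= (q - d)`! * q.+1 ^ q.
  elim: d => [|d IHd] ltdq; first by rewrite subn0.
  have := IHd (ltnW ltdq); rewrite -[q - d]prednK ?subn_gt0 // -subnS.
  rewrite factS expnS mulnCA -mulnA => le1.
  rewrite -(leq_pmul2l (ltn0Sn q)); apply: leq_trans le1 _.
  by apply: leq_mul => //; rewrite ltnS leq_subr.
case: (leqP q x) => [leqx | /ltnW lexq]; first by rewrite -(subnKC leqx).
by rewrite -(subKn lexq) down ?leq_subr.
Qed.

(** [fact_line] for k and n - k, with q the half of n, bounds k! (n-k)! below by exactly q! (n-q)!
    in either parity. *)
Lemma bin_le_middle n k : 'C(n, k) <= 'C(n, n./2).
Proof.
case: (leqP k n) => [lekn|ltnk]; last by rewrite bin_small.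
set q := n./2; have leqn : q <= n by rewrite /q; lia.
rewrite -(@leq_pmul2r (k`! * (n - k)`!)) ?muln_gt0 ?fact_gt0 // bin_fact //.
rewrite -(bin_fact leqn). rewrite leq_pmul2l ?bin_gt0 //.
rewrite -(@leq_pmul2r (q.+1 ^ (q + q))) ?expn_gt0 //.
have := leq_mul (fact_line q k) (fact_line q (n - k)).
rewrite mulnACA -expnD subnKC // [X in _ <= X]mulnACA -expnD.
apply: leq_trans; rewrite -!mulnA leq_pmul2l ?fact_gt0 //.
case: (boolP (odd n)) => oddn.
  have -> : n - q = q.+1 by rewrite /q; lia.
  have -> : n = (q + q).+1 by rewrite /q; lia.
  by rewrite factS mulnAC expnS mulnC mulnA.
have -> : n - q = q by rewrite /q; lia.
by have -> : n = q + q by rewrite /q; lia.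
Qed.

Lemma sum_card_exchange (A B : finType) (R : A -> B -> bool) :
  \sum_a #|[set b | R a b]| = \sum_b #|[set a | R a b]|.
Proof.
transitivity (\sum_a \sum_b (R a b : nat)).
  apply: eq_bigr => a _; rewrite -sum1_card [LHS]big_mkcond /=.
  by apply: eq_bigr => b _; rewrite inE; case: ifP.
rewrite exchange_big; apply: eq_bigr => b _.
rewrite -sum1_card [RHS]big_mkcond /=.
by apply: eq_bigr => a _; rewrite inE; case: ifP.
Qed.

Lemma card_permT (X : finType) : #|{perm X}| = #|X|`!.
Proof.
rewrite -[in RHS]cardsT -(card_perm [set: X]); apply: eq_card => p; rewrite !inE.
by apply/esym/subsetP => x; rewrite inE.
Qed.

(** List each set before its complement and match equal positions. *)
Lemma ex_perm_imset (X : finType) (J A : {set X}) :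
  #|J| = #|A| -> exists p : {perm X}, p @: J = A.
Proof.
move=> eqJA; pose s := enum J ++ enum (~: J); pose t := enum A ++ enum (~: A).
have size_s : size s = #|X| by rewrite size_cat -!cardE cardsC.
have size_t : size t = #|X| by rewrite size_cat -!cardE cardsC.
have uniq_t : uniq t.
  rewrite cat_uniq !enum_uniq andbT; apply/hasPn => x.
  by rewrite !mem_enum inE.
have mem_s x : x \in s by rewrite mem_cat !mem_enum inE orbN.
pose f x := nth x t (index x s).
have inj_f : injective f.
  move=> x y; rewrite /f (set_nth_default x y) ?size_t -?size_s ?index_mem //.
  move/eqP; rewrite nth_uniq ?size_t -?size_s ?index_mem // => /eqP eqi.
  by rewrite -[x](nth_index x (mem_s x)) eqi nth_index.
exists (perm inj_f); apply/eqP; rewrite eqEcard card_imset ?eqJA ?leqnn ?andbT //.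
  apply/subsetP => _ /imsetP[x Jx ->]; rewrite permE /f.
  have lti : index x s < size (enum A).
    by rewrite index_cat mem_enum Jx -cardE -eqJA cardE index_mem mem_enum.
  by rewrite nth_cat lti -mem_enum mem_nth.
exact: perm_inj.
Qed.

(** The permutations sending [J] to a given set of its size form a coset of the stabilizer of [J],
    so all these fibres are equally large. *)
Lemma card_perm_imset (X : finType) (J : {set X}) (H : {set {set X}}) :
  {in H, forall A : {set X}, #|A| = #|J|} ->
  #|[set p : {perm X} | p @: J \in H]| = #|H| * (#|J|`! * (#|X| - #|J|)`!).
Proof.
have fiber (A : {set X}) : #|A| = #|J| ->
    #|[set p : {perm X} | p @: J == A]| = #|[set p : {perm X} | p @: J == J]|.
  move=> /esym/ex_perm_imset[q qJ]; rewrite -[RHS](card_imset _ (mulIg q)).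
  apply: eq_card => p; rewrite !inE; apply/eqP/imsetP => [pJ|[p' + ->]].
    exists (p * q^-1)%g; last by rewrite mulgKV.
    rewrite inE -(inj_eq (imset_inj (@perm_inj _ q))) qJ -imset_comp -pJ.
    by apply/eqP/eq_imset => x; rewrite /= -permM mulgKV.
  rewrite inE => /eqP p'J; rewrite -qJ -[in RHS]p'J -imset_comp.
  by apply: eq_imset => x; rewrite permM.
have count (K : {set {set X}}) : {in K, forall A : {set X}, #|A| = #|J|} ->
    #|[set p : {perm X} | p @: J \in K]|
    = #|K| * #|[set p : {perm X} | p @: J == J]|.
  move=> cardK; rewrite -sum1_card.
  rewrite (partition_big (fun p : {perm X} => p @: J) (mem K)) => [|p]; last first.
    by rewrite inE.
  rewrite -sum_nat_const; apply: eq_bigr => A KA; rewrite -(fiber A) ?cardK //.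
  rewrite -sum1_card; apply: eq_bigl => p; rewrite !inE.
  by case: eqP => [->|]; rewrite ?andbF ?andbT.
move=> cardH; rewrite count //; congr (_ * _).
have leJX : #|J| <= #|X| by apply: max_card.
(* For the family of all sets of this size every permutation qualifies, which fixes the size of the
   stabilizer. *)
have := count [set A : {set X} | #|A| == #|J|].
rewrite card_draws => cnt; apply/eqP.
rewrite -(@eqn_pmul2l 'C(#|X|, #|J|)) ?bin_gt0 // bin_fact // -cnt; last first.
  by move=> A; rewrite inE => /eqP.
rewrite -card_permT -[eqbRHS]cardsT; apply/eqP/eq_card => p.
by rewrite !inE card_imset ?eqxx //; apply: perm_inj.
Qed.

(** Count pairs of a permutation [p] and a length [a] such that [p] maps the initial segment [J a]
    to a member of [F]: each [p] occurs at most once, since the images of the segments form a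
    chain. *)
Lemma lym (X : finType) (F : {set {set X}}) :
  {in F &, forall B C : {set X}, ~~ (B \proper C)} ->
  \sum_(A in F) #|A|`! * (#|X| - #|A|)`! <= #|X|`!.
Proof.
move=> acF; pose J (a : 'I_#|X|.+1) := [set x : X | enum_rank x < a].
have cardJ a : #|J a| = a.
  have lea : a <= #|X| by rewrite -ltnS.
  rewrite -[RHS]card_ord -(card_imset (f := fun i => enum_val (widen_ord lea i))).
    apply: eq_card => x; rewrite inE; apply/idP/imsetP => [ltx | [i _ ->]].
      exists (Ordinal ltx) => //; rewrite -[LHS]enum_rankK.
      by congr enum_val; apply: val_inj.
    by rewrite enum_valK /= ltn_ord.
  by move=> i j /enum_val_inj/(congr1 val)/= /val_inj.
pose Fa a := [set A in F | #|A| == a].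
have -> : \sum_(A in F) #|A|`! * (#|X| - #|A|)`!
          = \sum_(a < #|X|.+1) #|[set p : {perm X} | p @: J a \in F]|.
  rewrite (partition_big (fun A : {set X} => inord #|A| : 'I_#|X|.+1) predT) //=.
  apply: eq_bigr => a _.
  have -> : [set p : {perm X} | p @: J a \in F]
            = [set p : {perm X} | p @: J a \in Fa a].
    apply/setP => p; rewrite !inE card_imset ?cardJ ?eqxx ?andbT //.
    exact: perm_inj.
  rewrite card_perm_imset => [|A]; last by rewrite inE cardJ => /andP[_ /eqP].
  rewrite cardJ -sum_nat_const.
  have eqa (A : {set X}) : (inord #|A| == a) = (#|A| == a :> nat).
    by rewrite -val_eqE /= inordK // ltnS max_card.
  apply: eq_big => A; first by rewrite inE -eqa.
  by rewrite eqa => /andP[_ /eqP ->].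
rewrite sum_card_exchange.
rewrite -card_permT.
rewrite -[leqRHS]sum1_card; apply: leq_sum => p _.
apply/card_le1_eqP => a b; rewrite !inE => Fpa Fpb; apply/val_inj/eqP.
have sub (c d : 'I_#|X|.+1) : c < d -> p @: J c \proper p @: J d.
  move=> ltcd; rewrite properEcard !card_imset ?cardJ ?ltcd ?andbT;
    try exact: perm_inj.
  by apply: imsetS; apply/subsetP => x; rewrite !inE => /ltn_trans->.
case: ltngtP => // /sub prop; last by move: (acF _ _ Fpa Fpb); rewrite prop.
by move: (acF _ _ Fpb Fpa); rewrite prop.
Qed.

Lemma card_sperner (X : finType) (F : {set {set X}}) :
  {in F &, forall B C : {set X}, ~~ (B \proper C)} -> #|F| <= 'C(#|X|, #|X|./2).
Proof.
move/lym => lymF; have le2 : #|X|./2 <= #|X| by lia.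
rewrite -(@leq_pmul2r (#|X|./2`! * (#|X| - #|X|./2)`!)) ?muln_gt0 ?fact_gt0 //.
rewrite bin_fact //; apply: leq_trans lymF; rewrite -sum_nat_const.
apply: leq_sum => A _; have leA : #|A| <= #|X| by apply: max_card.
rewrite -(@leq_pmul2l 'C(#|X|, #|A|)) ?bin_gt0 // bin_fact //.
by rewrite -(bin_fact le2) leq_mul2r bin_le_middle orbT.
Qed.

Lemma card_sperner_in (X : finType) (D : {set X}) (F : {set {set X}}) :
  {in F, forall B : {set X}, B \subset D} ->
  {in F &, forall B C : {set X}, ~~ (B \proper C)} -> #|F| <= 'C(#|D|, #|D|./2).
Proof.
move=> subF acF; pose Y := {x | x \in D}.
pose f (B : {set X}) : {set Y} := [set y | val y \in B].
have fK (B : {set X}) : B \in F -> val @: f B = B.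
  move=> FB; apply/setP => x; apply/imsetP/idP => [[y + ->]|Bx].
    by rewrite inE.
  have Dx : x \in D by apply: (subsetP (subF B FB)).
  by exists (exist _ x Dx) => //; rewrite inE.
have cardY : #|{: Y}| = #|D| by rewrite card_sig.
rewrite -cardY -(card_in_imset (f := f) (D := F)); last first.
  by move=> B C FB FC eqf; rewrite -(fK B) // -(fK C) // eqf.
apply: card_sperner => _ _ /imsetP[B FB ->] /imsetP[C FC ->].
apply: contra (acF B C FB FC) => /(imset_proper (in2W val_inj)).
by rewrite !fK.
Qed.

Lemma card_inj_image (D X : finType) (P : pred {set X}) :
  #|[set f : {ffun D -> X} | injectiveb f && P (f @: setT)]|
  = #|D|`! * #|[set T : {set X} | (#|T| == #|D|) && P T]|.
Proof.
rewrite mulnC -sum_nat_const -sum1_card.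
rewrite (partition_big (fun f : {ffun D -> X} => f @: setT)
           (fun T => T \in [set T : {set X} | (#|T| == #|D|) && P T])) => [|f].
  apply: eq_bigr => T; rewrite inE => /andP[/eqP cardT PT].
  rewrite -ffactnn -[in X in X ^_ _]cardT -card_inj_ffuns_on -sum1_card.
  apply: eq_bigl => f; rewrite !inE andbC.
  apply/and3P/andP => [[/eqP <- inj_f _]|[/ffun_onP fT inj_f]].
    by split=> //; apply/ffun_onP => d; rewrite imset_f.
  suffices /eqP-> : f @: [set: D] == T by split.
  rewrite eqEcard card_imset ?cardsT ?cardT ?leqnn ?andbT; last exact/injectiveP.
  by apply/subsetP => _ /imsetP[d _ ->].
rewrite !inE => /andP[inj_f ->].
by rewrite card_imset ?cardsT ?eqxx //; apply/injectiveP.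
Qed.

Lemma ex_superset_card (X : finType) (S : {set X}) (r : nat) :
  #|S| <= r <= #|X| -> exists2 T : {set X}, S \subset T & #|T| = r.
Proof.
case/andP=> leSr lerX; pose s := take (r - #|S|) (enum (~: S)).
exists (S :|: [set x in s]); first exact: subsetUl.
rewrite cardsU disjoint_setI0 ?cards0 ?subn0; last first.
  rewrite disjoints_subset; apply/subsetP => x Sx; rewrite !inE.
  by apply/negP => /mem_take; rewrite mem_enum inE Sx.
rewrite cardsE (card_uniqP _) ?take_uniq ?enum_uniq // size_take -cardE.
by have := cardsC S; case: ltnP; lia.
Qed.

(* Averaging over the permutations of the ground set: the probability that a
   permuted image of a map lies in the monotone family P is at most the one for
   an r-set containing that image. *)
Lemma mono_family_density (X : finType) (P : pred {set X}) (r : nat) :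
  (forall S T : {set X}, S \subset T -> P S -> P T) -> r <= #|X| ->
  #|[set f : {ffun 'I_r -> X} | P (f @: setT)]| * #|X| ^_ r
    <= #|X| ^ r * (r`! * #|[set T : {set X} | (#|T| == r) && P T]|).
Proof.
move=> monoP lerX; pose q := #|[set f : {ffun 'I_r -> X} | P (f @: setT)]|.
pose u := #|[set T : {set X} | (#|T| == r) && P T]|.
rewrite -(@leq_pmul2r (#|X| - r)`!) ?fact_gt0 // -!mulnA ffact_fact //.
(* The image of [f] extends to an r-set [T], and monotonicity passes [P] from the permuted image to
   the permuted [T]. *)
have each (f : {ffun 'I_r -> X}) :
    #|[set p : {perm X} | P (p @: (f @: setT))]| <= r`! * u * (#|X| - r)`!.
  have [T subT cardT] : exists2 T : {set X}, f @: setT \subset T & #|T| = r.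
    have lefr : #|f @: setT| <= r.
      by rewrite (leq_trans (leq_imset_card _ _)) ?cardsT ?card_ord.
    by apply: ex_superset_card; rewrite lefr.
  rewrite -mulnA mulnCA -[in r`!]cardT -[in (_ - r)`!]cardT -card_perm_imset.
    apply: subset_leq_card; apply/subsetP => p; rewrite !inE => Pp.
    rewrite card_imset ?cardT ?eqxx /=; last exact: perm_inj.
    exact: monoP (imsetS _ subT) Pp.
  by move=> A; rewrite inE cardT => /andP[/eqP].
have := sum_card_exchange (fun (f : {ffun 'I_r -> X}) (p : {perm X}) =>
   P (p @: (f @: setT))).
(* Composing with a fixed permutation is a bijection of the maps, so every [p] sees the same number
   [q]. *)
rewrite [RHS](eq_bigr (fun _ => q)) => [|p _].
  rewrite sum_nat_const card_permT mulnC => <-.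
  set c := #|X| ^ r * _.
  suffices -> : c = \sum_(f : {ffun 'I_r -> X}) r`! * u * (#|X| - r)`!.
    by apply: leq_sum => f _; apply: each.
  by rewrite sum_nat_const card_ffun card_ord /c !mulnA.
pose h (f : {ffun 'I_r -> X}) : {ffun 'I_r -> X} := [ffun i => p (f i)].
rewrite /q -[RHS](on_card_preimset (f := h)).
  apply: eq_card => f; rewrite !inE -imset_comp; congr P.
  by apply: eq_imset => i; rewrite /= ffunE.
exists (fun f : {ffun 'I_r -> X} => [ffun i => p^-1%g (f i)]) => f _;
  apply/ffunP => i.
  by rewrite !ffunE permK.
by rewrite !ffunE permKV.
Qed.

(** * Ordered and unordered tuples *)

(* (1 + 1/x)^i <= 1 + i/x + (i/x)^2 for i <= x, which is at most 3. *)
Lemma expSn_le3 x i : i <= x -> x.+1 ^ i <= 3 * x ^ i.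
Proof.
move=> leix; case: (posnP x) leix => [->|x_gt0 leix]; first by case: i.
suffices le : x.+1 ^ i * x ^ 2 <= x ^ i * (x ^ 2 + i * x + i ^ 2).
  rewrite -(@leq_pmul2r (x ^ 2)) ?expn_gt0 ?x_gt0 //; apply: leq_trans le _.
  by rewrite mulnAC [leqRHS]mulnC leq_mul2l; apply/orP; right; nia.
elim: i leix => [|i IHi] ltix; first by rewrite !expn0 !mul1n; lia.
rewrite expnS -mulnA; apply: leq_trans (leq_mul (leqnn _) (IHi (ltnW ltix))) _.
by rewrite mulnCA (expnSr x i) -[leqRHS]mulnA leq_mul2l; apply/orP; right; nia.
Qed.

Lemma expnn_le3 r : r ^ r <= 3 ^ r * r`!.
Proof.
elim: r => // r IHr; rewrite expnS factS.
apply: leq_trans (leq_mul (leqnn _) (expSn_le3 (leqnn r))) _.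
by rewrite mulnCA [3 ^ _]expnS -mulnA leq_mul2l mulnCA leq_mul2l IHr orbT.
Qed.

(** Each factor N/(N-i) of the quotient is at most r/(r-i), so N = r is the worst case. *)
Lemma expn_le_ffact N r : r <= N -> N ^ r <= 3 ^ r * N ^_ r.
Proof.
move=> lerN; have le k : k <= r -> N ^ k * r ^_ k <= N ^_ k * r ^ k.
  elim: k => // k IHk ltkr; rewrite !ffactnSr !expnSr.
  rewrite mulnACA [leqRHS]mulnACA; apply: leq_mul; first exact/IHk/ltnW.
  by rewrite mulnBr mulnBl leq_sub2l // mulnC leq_mul2r lerN orbT.
have := le r (leqnn r); rewrite ffactnn => le1.
rewrite -(@leq_pmul2r r`!) ?fact_gt0 //; apply: leq_trans le1 _.
by rewrite mulnC mulnAC leq_mul2r expnn_le3 orbT.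
Qed.

(** Common form of [gamma0] and [beta0], with [P] being [spanning] or [no_common]. *)
Definition tuples_in (X : finType) (r : nat) (P : pred {set X}) (F : {set X}) :=
  [set T : {set X} | [&& T \subset F, #|T| == r & P T]].

Lemma tuples_in_upper (X : finType) (r : nat) (P : pred {set X}) (F : {set X}) :
  r`! * #|tuples_in r P F| =
  #|[set f : {ffun 'I_r -> X} |
      [&& f \in ffun_on F, injectiveb f & P (f @: setT)]]|.
Proof.
have := card_inj_image 'I_r (fun T => (T \subset F) && P T); rewrite card_ord.
have -> : [set T : {set X} | (#|T| == r) && ((T \subset F) && P T)]
          = tuples_in r P F.
  by apply/setP => T; rewrite !inE andbCA.
move=> <-; apply: eq_card => f; rewrite !inE andbCA; congr (_ && (_ && _)).
apply/subsetP/ffun_onP => [sub i|onF _ /imsetP[i _ ->]//].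
by apply: sub; rewrite imset_f.
Qed.

(** The maps on the left may repeat members; [mono_family_density] on the subtype of [F], followed
    by [expn_le_ffact], bounds the cost of forbidding this. *)
Lemma tuples_in_lower (X : finType) (r : nat) (P : pred {set X}) (F : {set X}) :
  (forall S T : {set X}, S \subset T -> P S -> P T) -> r <= #|F| ->
  #|[set f : {ffun 'I_r -> X} | (f \in ffun_on F) && P (f @: setT)]|
    <= 3 ^ r * r`! * #|tuples_in r P F|.
Proof.
move=> monoP lerF; pose Y := {x | x \in F}.
have cardY : #|{: Y}| = #|F| by rewrite card_sig.
pose PY (T : {set Y}) := P (val @: T).
have := @mono_family_density Y PY r; rewrite cardY => /(_ _ lerF) dens.
have {dens} : #|[set f : {ffun 'I_r -> Y} | PY (f @: setT)]| * #|F| ^_ r <=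
   #|F| ^ r * (r`! * #|[set T : {set Y} | (#|T| == r) && PY T]|).
  by apply: dens => S T subST; apply/monoP/imsetS.
set q := #|[set f : {ffun 'I_r -> Y} | _]|; set u := #|[set T : {set Y} | _]|.
move=> dens; have leq_q : #|[set f : {ffun 'I_r -> X} |
    (f \in ffun_on F) && P (f @: setT)]| <= q.
  pose g (f : {ffun 'I_r -> Y}) := [ffun i => val (f i)].
  apply: leq_trans (leq_imset_card g _).
  apply/subset_leq_card/subsetP => f; rewrite inE => /andP[/ffun_onP fF Pf].
  apply/imsetP; exists [ffun i => exist _ (f i) (fF i) : Y].
    rewrite inE /PY -imset_comp; apply: etrans Pf; congr P; apply: eq_imset => i.
    by rewrite /= ffunE.
  by apply/ffunP => i; rewrite !ffunE.
have leq_u : u <= #|tuples_in r P F|.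
  rewrite /u -(card_imset _ (imset_inj (@val_inj _ _ Y))).
  apply/subset_leq_card/subsetP => _ /imsetP[T + ->].
  rewrite !inE card_imset; last exact: val_inj.
  case/andP=> -> PT; apply/andP; split=> //.
  by apply/subsetP => _ /imsetP[y _ ->]; apply: valP.
apply: leq_trans leq_q _.
rewrite -(@leq_pmul2r (#|F| ^_ r)) ?ffact_gt0 //; apply: leq_trans dens _.
apply: leq_trans (leq_mul (expn_le_ffact lerF) (leqnn _)) _.
by rewrite mulnAC leq_mul2r -!mulnA !leq_mul2l leq_u !orbT.
Qed.

(** * Tuples as maps from points to types *)

Section Sizes.
Variables (r n : nat).
Local Notation tup := {ffun 'I_r -> {set 'I_n}}.
Implicit Type f : tup.

Definition meet0 f := [forall j, [exists i, j \notin f i]].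
Definition join1 f := [forall j, [exists i, j \in f i]].

Lemma bigcap_imset_eq0 f : (\bigcap_(B in f @: setT) B == set0) = meet0 f.
Proof.
apply/eqP/forallP => [cap0 j|cap0].
  apply/existsP; case: (pickP (fun i => j \notin f i)) => [i ji|all];
    first by exists i.
  have: j \in \bigcap_(B in f @: setT) B.
    by apply/bigcapP => _ /imsetP[i _ ->]; have := all i => /negbFE.
  by rewrite cap0 inE.
apply/setP => j; rewrite inE; apply/negP => /bigcapP jin.
by have /existsP[i /negP[]] := cap0 j; rewrite jin ?imset_f.
Qed.

Lemma bigcup_imset_eqT f : (\bigcup_(B in f @: setT) B == setT) = join1 f.
Proof.
apply/eqP/forallP => [cupT j|cupT].
  have : j \in \bigcup_(B in f @: setT) B by rewrite cupT inE.
  by case/bigcupP => _ /imsetP[i _ ->] ji; apply/existsP; exists i.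
apply/setP => j; rewrite inE; have /existsP[i ji] := cupT j.
by apply/bigcupP; exists (f i); rewrite ?imset_f.
Qed.

(** Transposing the incidence relation turns a tuple into a map from points to types, and the types
    are chosen independently. *)
Lemma card_transpose (Q : pred {set 'I_r}) :
  #|[set f : tup | [forall j, Q [set i | j \in f i]]]| = #|Q| ^ n.
Proof.
rewrite -[in RHS](card_ord n) -card_ffun_on.
pose h (g : {ffun 'I_n -> {set 'I_r}}) : {ffun 'I_r -> {set 'I_n}} :=
  [ffun i => [set j | i \in g j]].
rewrite -(card_imset (f := h)) => [|g g' /ffunP eqh]; last first.
  by apply/ffunP => j; apply/setP => i; have /setP/(_ j) := eqh i;
    rewrite !ffunE !inE.
apply: eq_card => f; rewrite inE; apply/forallP/imsetP => [Qf|[g /ffun_onP gQ ->] j].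
  exists [ffun j => [set i | j \in f i]]; first by apply/ffun_onP => j;
    rewrite ffunE; apply: Qf.
  by apply/ffunP => i; apply/setP => j; rewrite !ffunE inE ffunE inE.
suff -> : [set i | j \in h g i] = g j by apply: gQ.
by apply/setP => i; rewrite inE ffunE inE.
Qed.

Lemma card_meet0 : #|[set f : tup | meet0 f]| = (2 ^ r).-1 ^ n.
Proof.
have -> : (2 ^ r).-1 = #|[pred v : {set 'I_r} | v != setT]|.
  have := cardC (pred1 (setT : {set 'I_r})); rewrite card1 -cardsT -powersetT.
  by rewrite card_powerset cardsT card_ord => <-; apply: eq_card.
rewrite -card_transpose; apply: eq_card => f; rewrite !inE.
apply: eq_forallb => j; apply/existsP/idP => [[i ji]|].
  by apply/negP => /eqP/setP/(_ i); rewrite !inE (negPf ji).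
move=> /= neT; apply/existsP; apply: contraR neT => none; apply/eqP/setP => i;
  rewrite !inE; apply: contraR none => ji.
by apply/existsP; exists i.
Qed.

Lemma card_meet0_join1 : 0 < r ->
  #|[set f : tup | meet0 f && join1 f]| = (2 ^ r - 2) ^ n.
Proof.
move=> r_gt0; have -> : 2 ^ r - 2 = #|[pred v : {set 'I_r} | (v != set0) && (v !=
  setT)]|.
  have neq0T : set0 != setT :> {set 'I_r}.
    by apply/eqP => /setP/(_ (Ordinal r_gt0)); rewrite !inE.
  have := cardC (pred2 (set0 : {set 'I_r}) setT); rewrite card2 neq0T.
  rewrite -cardsT -powersetT card_powerset cardsT card_ord => <-.
  by rewrite addKn; apply: eq_card => v; rewrite !inE negb_or.
rewrite -card_transpose; apply: eq_card => f; rewrite !inE.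
apply/andP/forallP => [[/forallP m0 /forallP j1] j|Qf].
  have /existsP[i ji] := m0 j; have /existsP[k jk] := j1 j; apply/andP; split.
    by apply/negP => /eqP/setP/(_ k); rewrite !inE jk.
  by apply/negP => /eqP/setP/(_ i); rewrite !inE (negPf ji).
split; apply/forallP => j; have /andP[n0 nT] := Qf j.
  apply: contraR nT => none; apply/eqP/setP => i; rewrite !inE;
    apply: contraR none => ji.
  by apply/existsP; exists i.
by have /set0Pn[i] := n0; rewrite inE => ji; apply/existsP; exists i.
Qed.

End Sizes.

(** * Tuples of sets of half size *)

(** Cauchy-Schwarz for the sizes [c k] of the fibres of [h] on [W]; the collisions number the sum of
    their squares. *)
Lemma sqr_card_le_collisions (X K : finType) (W : {set X}) (h : X -> K) :
  #|W| ^ 2 <= #|K| * #|[set x : X * X | [&& x.1 \in W, x.2 \in W & h x.1 == h x.2]]|.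
Proof.
pose c k := #|[set x in W | h x == k]|.
have -> : #|W| = \sum_k c k.
  rewrite -sum1_card (partition_big h predT) //=; apply: eq_bigr => k _.
  by rewrite /c -sum1_card; apply: eq_bigl => x; rewrite inE.
have -> : #|[set x : X * X | [&& x.1 \in W, x.2 \in W & h x.1 == h x.2]]|
          = \sum_k c k ^ 2.
  rewrite -sum1_card (partition_big (fun x => h x.1) predT) //=.
  apply: eq_bigr => k _; rewrite /c -mulnn -cardsX -sum1_card.
  apply: eq_bigl => -[x y]; rewrite !inE /=.
  by case: (h x =P k) => [<-|]; rewrite ?andbT ?andbF //= eq_sym.
rewrite -(@leq_pmul2l 2) // -mulnn big_distrlr big_distrr /=.
have -> : 2 * (#|K| * \sum_k c k ^ 2) = \sum_k \sum_l (c k ^ 2 + c l ^ 2).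
  rewrite [RHS](eq_bigr (fun k => #|K| * c k ^ 2 + \sum_l c l ^ 2)) => [|k _];
    last first.
    by rewrite big_split sum_nat_const.
  by rewrite big_split /= -big_distrr sum_nat_const /= addnn mul2n.
apply: leq_sum => k _; rewrite big_distrr; apply: leq_sum => l _.
exact: (nat_Cauchy _ _).1.
Qed.

Section Glue.
Variables (r m n : nat).
Implicit Types (f : {ffun 'I_r -> {set 'I_m}}) (g : {ffun 'I_r -> {set 'I_n}}).

Definition glue f g : {ffun 'I_r -> {set 'I_(m + n)}} :=
  [ffun i => [set j | match split j with inl a => a \in f i | inr b => b \in g i
    end]].

Lemma in_glue_l f g i (a : 'I_m) : (lshift n a \in glue f g i) = (a \in f i).
Proof. by rewrite ffunE inE (unsplitK (inl a)). Qed.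

Lemma in_glue_r f g i (b : 'I_n) : (rshift m b \in glue f g i) = (b \in g i).
Proof. by rewrite ffunE inE (unsplitK (inr b)). Qed.

Lemma card_glue f g i : #|glue f g i| = #|f i| + #|g i|.
Proof.
rewrite -sum1_card big_mkcond big_split_ord -!sum1_card /=; congr (_ + _).
  by rewrite [RHS]big_mkcond; apply: eq_bigr => a _; rewrite in_glue_l.
by rewrite [RHS]big_mkcond; apply: eq_bigr => b _; rewrite in_glue_r.
Qed.

Lemma glue_inj f f' g g' : glue f g = glue f' g' -> f = f' /\ g = g'.
Proof.
move=> eqg; split; apply/ffunP => i; apply/setP => j.
  by rewrite -(in_glue_l f g) eqg in_glue_l.
by rewrite -(in_glue_r f g) eqg in_glue_r.
Qed.

Lemma glue_meet0 f g : meet0 (glue f g) = meet0 f && meet0 g.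
Proof.
apply/forallP/andP => [m0|[/forallP mf /forallP mg] j].
  split; apply/forallP => j.
    by have /existsP[i] := m0 (lshift n j); rewrite in_glue_l => ji; apply/existsP;
      exists i.
  by have /existsP[i] := m0 (rshift m j); rewrite in_glue_r => ji; apply/existsP;
    exists i.
rewrite -(splitK j); case: (split j) => a /=; apply/existsP.
  by have /existsP[i] := mf a; exists i; rewrite in_glue_l.
by have /existsP[i] := mg a; exists i; rewrite in_glue_r.
Qed.

Lemma glue_join1 f g : join1 (glue f g) = join1 f && join1 g.
Proof.
apply/forallP/andP => [m0|[/forallP mf /forallP mg] j].
  split; apply/forallP => j.
    by have /existsP[i] := m0 (lshift n j); rewrite in_glue_l => ji; apply/existsP;
      exists i.
  by have /existsP[i] := m0 (rshift m j); rewrite in_glue_r => ji; apply/existsP;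
    exists i.
rewrite -(splitK j); case: (split j) => a /=; apply/existsP.
  by have /existsP[i] := mf a; exists i; rewrite in_glue_l.
by have /existsP[i] := mg a; exists i; rewrite in_glue_r.
Qed.

End Glue.

Definition regular_tuples (r n k : nat) :=
  [set f : {ffun 'I_r -> {set 'I_n}} |
    [&& meet0 f, join1 f & [forall i, #|f i| == k]]].

(** There are (m+1)^r size profiles. If [f] and [g] share one, gluing [f] to the complements of [g]
    gives sets of size |f i| + m - |g i| = m. *)
Lemma regular_tuples_half r m : 0 < r ->
  (2 ^ r - 2) ^ (m + m) <= m.+1 ^ r * #|regular_tuples r (m + m) m|.
Proof.
move=> r_gt0; pose W := [set f : {ffun 'I_r -> {set 'I_m}} | meet0 f && join1 f].
pose h (f : {ffun 'I_r -> {set 'I_m}}) : {ffun 'I_r -> 'I_m.+1} :=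
  [ffun i => inord #|f i|].
have := sqr_card_le_collisions W h.
rewrite card_meet0_join1 // -expnM muln2 -addnn card_ffun !card_ord.
move=> /leq_trans; apply; rewrite leq_mul2l; apply/orP; right.
pose co (f : {ffun 'I_r -> {set 'I_m}}) : {ffun 'I_r -> {set 'I_m}} :=
  [ffun i => ~: f i].
pose gl (x : {ffun 'I_r -> {set 'I_m}} * {ffun 'I_r -> {set 'I_m}}) := glue x.1 (co
  x.2).
rewrite -(card_imset (f := gl)) => [|[f g] [f' g'] /glue_inj[/= -> /ffunP eqg]];
  last first.
  by congr pair; apply/ffunP => i; apply: setC_inj; have := eqg i; rewrite !ffunE.
apply/subset_leq_card/subsetP => _ /imsetP[[f g] + ->].
rewrite !inE /= => /and3P[/andP[mf jf] /andP[mg jg] /eqP eqh].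
rewrite glue_meet0 glue_join1 mf jf /=; apply/and3P; split.
- apply/forallP => j; have /existsP[i ji] := forallP jg j; apply/existsP.
  by exists i; rewrite ffunE inE ji.
- apply/forallP => j; have /existsP[i ji] := forallP mg j; apply/existsP.
  by exists i; rewrite ffunE inE ji.
apply/forallP => i; rewrite card_glue ffunE.
have /ffunP/(_ i)/(congr1 val) := eqh.
rewrite !ffunE /= !inordK ?ltnS -?[leqRHS](card_ord m) ?max_card //.
by rewrite -[X in _ == X](card_ord m) -(cardsC (g i)) => ->.
Qed.

Lemma regular_tuples_glue r m n k l :
  #|regular_tuples r m k| * #|regular_tuples r n l|
    <= #|regular_tuples r (m + n) (k + l)|.
Proof.
rewrite -cardsX -(card_imset (f := fun x => glue x.1 x.2)); last first.
  by move=> [f g] [f' g'] /= /glue_inj[-> ->].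
apply/subset_leq_card/subsetP => _ /imsetP[[f g] + ->].
rewrite !inE /= => /andP[/and3P[mf jf /forallP kf] /and3P[mg jg /forallP lg]].
rewrite glue_meet0 glue_join1 mf jf mg jg /=; apply/forallP => i.
by rewrite card_glue (eqP (kf i)) (eqP (lg i)).
Qed.

Lemma leq_card_bigcup (I X : finType) (F : I -> {set X}) :
  #|\bigcup_i F i| <= \sum_i #|F i|.
Proof.
elim/big_ind2: _ => [|a A b B leA leB|//]; first by rewrite cards0.
by rewrite (leq_trans (leq_card_setU A B)) ?leq_add.
Qed.

(** Surjections of the indices onto three points are read as tuples of singletons; a union bound
    over the missed point counts them. *)
Lemma regular_tuples_3 r : 1 < r -> 3 ^ r - 3 * 2 ^ r <= #|regular_tuples r 3 1|.
Proof.
move=> r_gt1; pose S := [set s : {ffun 'I_r -> 'I_3} | [forall j, [exists i, s i ==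
  j]]].
have leS : 3 ^ r - 3 * 2 ^ r <= #|S|.
  have := cardsC S; rewrite card_ffun !card_ord => <-; rewrite leq_subLR addnC.
  rewrite leq_add2r; have -> : 3 * 2 ^ r = \sum_(j < 3) #|[set s : {ffun 'I_r ->
    'I_3} | s \in ffun_on (predC1 j)]|.
    rewrite (eq_bigr (fun=> 2 ^ r)) ?sum_nat_const ?card_ord // => j _.
    by rewrite cardsE card_ffun_on cardC1 !card_ord.
  apply: leq_trans (leq_card_bigcup _).
  apply/subset_leq_card/subsetP => s; rewrite !inE negb_forall => /existsP[j].
  rewrite negb_exists => /forallP sj; apply/bigcupP; exists j => //.
  by rewrite inE; apply/ffun_onP.
apply: leq_trans leS _.
rewrite -(card_imset (f := fun s : {ffun 'I_r -> 'I_3} => [ffun i => [set s i]]));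
  last first.
  move=> s s' /ffunP eqs; apply/ffunP => i; have := eqs i; rewrite !ffunE.
  exact: set1_inj.
apply/subset_leq_card/subsetP => _ /imsetP[s + ->]; rewrite !inE => /forallP onto.
apply/and3P; split; apply/forallP => j.
- have [j' neqj] : exists j' : 'I_3, j != j'.
    by exists (if j == ord0 then ord_max else ord0); case: ifP => [/eqP->|/negbT].
  have /existsP[i /eqP si] := onto j'; apply/existsP; exists i.
  by rewrite ffunE inE si.
- have /existsP[i /eqP si] := onto j; apply/existsP; exists i.
  by rewrite ffunE inE si.
by rewrite ffunE cards1.
Qed.

(** * Tuples of sets with prescribed sizes *)

(* Each edge x -- y gets weight 1/deg x; a vertex y then receives at most 1. *)
Lemma leq_card_degrees (X Y : finType) (A : {set X}) (B : {set Y})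
    (E : X -> Y -> bool) :
  {in A, forall x, 0 < #|[set y in B | E x y]|} ->
  {in A & B, forall x y,
     E x y -> #|[set x' in A | E x' y]| <= #|[set y' in B | E x y']|} ->
  #|A| <= #|B|.
Proof.
move=> deg_gt0 deg_le; rewrite -(ler_nat rat).
pose dx x := #|[set y in B | E x y]|; pose dy y := #|[set x in A | E x y]|.
have -> : (#|A|%:R = \sum_(x in A) \sum_(y in B | E x y) (dx x)%:R^-1 :> rat)%R.
  rewrite -sum1_card natr_sum; apply: eq_bigr => x Ax.
  rewrite (eq_bigl (mem [set y in B | E x y])) => [|y]; last by rewrite !inE.
  rewrite sumr_const -[RHS]mulr_natr mulVf //.
  by rewrite pnatr_eq0 -lt0n deg_gt0.
rewrite (exchange_big_dep (mem B)) /=; last by move=> x y _ /andP[].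
rewrite -sum1_card natr_sum; apply: ler_sum => y By.
apply: (@le_trans _ _ (\sum_(x in A | E x y) (dy y)%:R^-1)%R).
  rewrite [X in (X <= _)%R](eq_bigl (fun x => (x \in A) && E x y)); last first.
    by move=> x /=; rewrite By.
  apply: ler_sum => x /andP[Ax Exy].
  have dy_gt0 : 0 < dy y by apply/card_gt0P; exists x; rewrite inE Ax.
  rewrite lef_pV2 ?posrE ?ltr0n ?deg_gt0 //.
  by rewrite ler_nat; apply: deg_le.
rewrite (eq_bigl (mem [set x in A | E x y])) => [|x]; last by rewrite !inE.
rewrite sumr_const -[X in (X <= _)%R]mulr_natr -/(dy y).
have [->|dy_neq0] := eqVneq (dy y) 0; first by rewrite mulr0n mulr0 ler01.
by rewrite mulVf ?lexx ?pnatr_eq0.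
Qed.

Section Profiles.
Variables r n : nat.
Local Notation tup := {ffun 'I_r -> {set 'I_n}}.
Implicit Types (f g : tup) (k : 'I_r -> nat).

Definition meet_tuples k := [set f : tup | meet0 f && [forall i, #|f i| == k i]].

Lemma meet_tuples_ext k k' : k =1 k' -> meet_tuples k = meet_tuples k'.
Proof.
by move=> eqk; apply/setP => f; rewrite !inE; congr (_ && _);
  apply: eq_forallb => i; rewrite eqk.
Qed.

Definition shift (i j : 'I_r) (x : 'I_n) f : tup :=
  [ffun l => if l == i then f i :\ x else if l == j then x |: f j else f l].

Lemma shiftK i j x f : x \in f i :\: f j -> shift j i x (shift i j x f) = f.
Proof.
rewrite inE => /andP[xj xi]; have neqij : i != j by apply: contraNneq xj => <-.
apply/ffunP => l; rewrite !ffunE !eqxx (eq_sym j i) (negPf neqij).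
case: eqP => [->|_]; first by rewrite setU1K.
by case: eqP => [->|//]; rewrite setD1K.
Qed.

Lemma shift_meet0 i j x f : x \in f i :\: f j -> meet0 f -> meet0 (shift i j x f).
Proof.
rewrite inE => /andP[xj xi] /forallP m0; apply/forallP => y; apply/existsP.
have [->|neqyx] := eqVneq y x; first by exists i; rewrite ffunE eqxx !inE eqxx.
have /existsP[l yl] := m0 y; exists l; rewrite ffunE.
case: eqP => [eql|_]; first by rewrite !inE -eql (negPf yl) andbF.
by case: eqP => [eql|//]; rewrite !inE -eql (negPf neqyx).
Qed.

Lemma shift_setI i j x f :
  x \in f i :\: f j -> shift i j x f i :&: shift i j x f j = f i :&: f j.
Proof.
rewrite inE => /andP[xj xi]; have neqij : i != j by apply: contraNneq xj => <-.
apply/setP => y; rewrite !ffunE !eqxx (eq_sym j i) (negPf neqij) !inE.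
by have [->|_] := eqVneq y x; rewrite ?(negPf xj) ?andbF ?andbT.
Qed.

Definition transfer k (i j l : 'I_r) :=
  if l == i then (k i).-1 else if l == j then (k j).+1 else k l.

(** Join [f] to its images under moving one point from [f i] to [f j]. A move preserves the size t
    of the intersection of these two sets; [f] has at least k i - t neighbours, a target at most k j
    + 1 - t. *)
Lemma leq_meet_tuples_transfer k i j :
  (k j).+1 < k i -> #|meet_tuples k| <= #|meet_tuples (transfer k i j)|.
Proof.
move=> ltk; have neqij : i != j by apply: contraTneq ltk => ->; lia.
have neqji : j == i = false by rewrite eq_sym (negPf neqij).
pose E (f g : tup) := [exists x in f i :\: f j, g == shift i j x f].
have out f : f \in meet_tuples k ->
    #|f i :\: f j| <= #|[set g in meet_tuples (transfer k i j) | E f g]|.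
  rewrite inE => /andP[m0 /forallP kf].
  have inj : {in f i :\: f j &, injective (fun x => shift i j x f)}.
    move=> x y; rewrite !inE => /andP[xj _] _ /ffunP/(_ j)/setP/(_ x).
    by rewrite !ffunE !eqxx neqji !inE eqxx (negPf xj) !orbF => /esym/eqP.
  rewrite -(card_in_imset inj); apply/subset_leq_card/subsetP => _ /imsetP[x xij ->].
  rewrite !inE shift_meet0 //=; apply/andP; split; last first.
    by apply/existsP; exists x; rewrite xij eqxx.
  move: xij; rewrite inE => /andP[xj xi].
  apply/forallP => l; rewrite ffunE /transfer.
  case: (l =P i) => _; first by rewrite -(eqP (kf i)) (cardsD1 x (f i)) xi.
  case: (l =P j) => _; last exact: kf.
  by rewrite cardsU1 xj (eqP (kf j)).
have cardD f : f \in meet_tuples k -> #|f i :\: f j| = k i - #|f i :&: f j|.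
  by rewrite inE cardsD => /andP[_ /forallP/(_ i)/eqP->].
apply: (@leq_card_degrees _ _ _ _ E) => [f Mf|f g Mf].
  apply: leq_trans (out f Mf); rewrite cardD // subn_gt0.
  apply: leq_ltn_trans (subset_leq_card (subsetIr (f i) (f j))) _.
  by move: Mf; rewrite inE => /andP[_ /forallP/(_ j)/eqP->]; apply: ltnW.
rewrite inE => /andP[_ /forallP kg] /existsP[x /andP[xij /eqP eqg]].
apply: leq_trans (out f Mf); rewrite cardD // -(shift_setI xij) -eqg.
apply: (@leq_trans #|g j :\: g i|); last first.
  rewrite cardsD (eqP (kg j)) /transfer eqxx neqji (setIC (g j));
    exact/leq_sub2r/ltnW.
apply: leq_trans (leq_imset_card (fun x => shift j i x g) _).
apply/subset_leq_card/subsetP => f'; rewrite inE => /andP[_].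
case/existsP => y /andP[yij /eqP eqg']; apply/imsetP; exists y.
  by rewrite eqg' inE !ffunE !eqxx neqji !inE !eqxx.
by rewrite eqg' shiftK.
Qed.

(** Removing a point of [f i] keeps the intersection empty, and the point together with the smaller
    tuple recovers [f]. *)
Lemma leq_meet_tuples_pred k i : 0 < k i ->
  #|meet_tuples k|
    <= n * #|meet_tuples (fun l => if l == i then (k i).-1 else k l)|.
Proof.
move=> ki_gt0; rewrite -[X in X * _](card_ord n) -[X in X * _]cardsT -cardsX.
pose add (z : 'I_n * tup) : tup :=
  [ffun l => if l == i then z.1 |: z.2 i else z.2 l].
apply: leq_trans (leq_imset_card add _).
apply/subset_leq_card/subsetP => f; rewrite inE => /andP[/forallP m0 /forallP kf].
have /card_gt0P[x xi] : 0 < #|f i| by rewrite (eqP (kf i)).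
apply/imsetP; exists (x, [ffun l => if l == i then f i :\ x else f l]).
  rewrite !inE /=; apply/andP; split; apply/forallP => l.
    have /existsP[l' ll'] := m0 l; apply/existsP; exists l'; rewrite ffunE.
    by case: eqP => [eql'|//]; rewrite !inE -eql' (negPf ll') andbF.
  rewrite ffunE; case: (l =P i) => _; last exact: kf.
  by rewrite -(eqP (kf i)) (cardsD1 x (f i)) xi.
apply/ffunP => l; rewrite !ffunE /=; case: eqP => [->|//].
by rewrite eqxx setD1K.
Qed.

Lemma leq_meet_tuples_const k l :
  (forall i, k i = l \/ k i = l.+1) ->
  #|meet_tuples k| <= n ^ #|[set i | k i == l.+1]| * #|meet_tuples (fun=> l)|.
Proof.
move eqa : #|[set i | k i == l.+1]| => a; elim: a k eqa => [|a IHa] k eqa kl.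
  rewrite expn0 mul1n (@meet_tuples_ext k (fun=> l)) // => i.
  by case: (kl i) => // ki; have := in_set0 i; rewrite -(cards0_eq eqa) inE ki eqxx.
have /card_gt0P[i] : 0 < #|[set i | k i == l.+1]| by rewrite eqa.
rewrite inE => /eqP ki; have ki_gt0 : 0 < k i by rewrite ki.
apply: leq_trans (leq_meet_tuples_pred ki_gt0) _; rewrite expnS -mulnA leq_mul2l.
apply/orP; right; apply: IHa => [|j]; last first.
  by case: eqP => // _; rewrite ki; left.
move: eqa; rewrite (cardsD1 i) inE ki eqxx add1n => -[<-]; apply: eq_card => j.
by rewrite !inE; case: (j =P i) => //= _; rewrite ltn_eqF.
Qed.

(** Makes the sum of squared sizes a measure for repeated transfers. *)
Lemma sum_sqr_transfer k i j : (k j).+1 < k i ->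
  \sum_l transfer k i j l ^ 2 < \sum_l k l ^ 2.
Proof.
move=> ltk; have neqij : i != j by apply: contraTneq ltk => ->; lia.
pose rest := \sum_(l | (l != i) && (l != j)) k l ^ 2.
have -> : \sum_l k l ^ 2 = k i ^ 2 + (k j ^ 2 + rest).
  by rewrite (bigD1 i) // (bigD1 j) // eq_sym.
have -> : \sum_l transfer k i j l ^ 2 = (k i).-1 ^ 2 + ((k j).+1 ^ 2 + rest).
  rewrite (bigD1 i) // (bigD1 j) /=; last by rewrite eq_sym.
  rewrite /transfer eqxx (eq_sym j) (negPf neqij) eqxx; congr (_ + (_ + _)).
  by apply: eq_bigr => l /andP[/negPf-> /negPf->].
rewrite !addnA ltn_add2r -(subnKC ltk); set c := _ - _; set b := k j.
rewrite (_ : _.-1 = b.+1 + c) // -!mulnn; lia.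
Qed.

(** Transfers go on while two sizes differ by at least 2, and they keep all sizes strictly between 0
    and n. Afterwards only the minimum and its successor occur. *)
Lemma leq_meet_tuples_balanced k : 0 < r -> (forall i, 0 < k i < n) ->
  exists2 l, 0 < l < n & #|meet_tuples k| <= n ^ r.-1 * #|meet_tuples (fun=> l)|.
Proof.
move=> r_gt0; have [m] := ubnP (\sum_l k l ^ 2).
elim: m k => // m IHm k; rewrite ltnS => lem kn.
case: (boolP [exists i, exists j, (k j).+1 < k i]) => [/existsP[i /existsP[j ltk]]|].
  have [|l|l ln le] := IHm (transfer k i j).
  - exact: leq_trans (sum_sqr_transfer ltk) lem.
  - have := (kn i, kn j, kn l); rewrite /transfer => -[[kni knj] knl].
    by case: (l =P i) => _; [lia|case: (l =P j) => _; lia].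
  by exists l => //; apply: leq_trans (leq_meet_tuples_transfer ltk) le.
rewrite negb_exists => /forallP bal.
have balP i j : k i <= (k j).+1.
  by rewrite leqNgt; have := bal i; rewrite negb_exists => /forallP.
pose i0 := Ordinal r_gt0; pose i1 := [arg min_(i < i0) k i].
have minP i : k i1 <= k i by rewrite /i1; case: arg_minnP => // i' _; apply.
exists (k i1); first exact: kn.
have kl i : k i = k i1 \/ k i = (k i1).+1.
  by have := minP i; have := balP i i1; lia.
apply: leq_trans (leq_meet_tuples_const kl) _; rewrite leq_mul2r; apply/orP; right.
apply: leq_pexp2l; first by have := kn i0; lia.
(* A set attaining the minimum undergoes no deletion, hence the exponent r - 1. *)
rewrite -ltnS prednK // -[leqRHS](card_ord r) -[leqRHS]cardsT.
by apply: proper_card; rewrite properE subsetT; apply/subsetPn; exists i1;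
  rewrite ?inE //; lia.
Qed.

End Profiles.

(** * At least three sets *)

Definition no_common n (T : {set {set 'I_n}}) := \bigcap_(B in T) B == set0.

Definition spanning n (T : {set {set 'I_n}}) :=
  (\bigcap_(B in T) B == set0) && (\bigcup_(B in T) B == setT).

Lemma no_common_mono n (S T : {set {set 'I_n}}) :
  S \subset T -> no_common S -> no_common T.
Proof.
move=> /subsetP sub /eqP capS; rewrite /no_common -subset0 -capS.
by apply/bigcapsP => B SB; apply: bigcap_inf; apply: sub.
Qed.

Lemma spanning_mono n (S T : {set {set 'I_n}}) :
  S \subset T -> spanning S -> spanning T.
Proof.
move=> subST /andP[capS /eqP cupS]; apply/andP; split.
  exact: no_common_mono subST capS.
rewrite eqEsubset subsetT -cupS; apply/bigcupsP => B SB.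
by apply: bigcup_sup; apply: (subsetP subST).
Qed.

Lemma gamma0E r n (F : {set {set 'I_n}}) :
  gamma0 r F = #|tuples_in r (@spanning n) F|.
Proof. by []. Qed.

Lemma beta0E r n (F : {set {set 'I_n}}) :
  beta0 r F = #|tuples_in r (@no_common n) F|.
Proof. by []. Qed.

Lemma gamma0_le_beta0 r n (F : {set {set 'I_n}}) : gamma0 r F <= beta0 r F.
Proof.
apply/subset_leq_card/subsetP => T; rewrite !inE.
by case/and4P=> -> -> -> _.
Qed.

Lemma gamma0_upper r n (F : {set {set 'I_n}}) :
  0 < r -> r`! * gamma0 r F <= (2 ^ r - 2) ^ n.
Proof.
move=> r_gt0; rewrite gamma0E tuples_in_upper -card_meet0_join1 //.
apply/subset_leq_card/subsetP => f; rewrite !inE => /and3P[_ _].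
by rewrite /spanning bigcap_imset_eq0 bigcup_imset_eqT.
Qed.

Lemma beta0_upper r n (F : {set {set 'I_n}}) : r`! * beta0 r F <= (2 ^ r).-1 ^ n.
Proof.
rewrite beta0E tuples_in_upper -card_meet0.
apply/subset_leq_card/subsetP => f; rewrite !inE => /and3P[_ _].
by rewrite /no_common bigcap_imset_eq0.
Qed.

Lemma card_layer n k : #|layer n k| = 'C(n, k).
Proof. by rewrite card_draws card_ord. Qed.

Lemma gamma0_layer_lower r n k : r <= 'C(n, k) ->
  #|regular_tuples r n k| <= 3 ^ r * r`! * gamma0 r (layer n k).
Proof.
rewrite -card_layer gamma0E => lerC.
apply: leq_trans (tuples_in_lower (@spanning_mono n) lerC).
apply/subset_leq_card/subsetP => f; rewrite !inE => /and3P[m0 j1 /forallP fk].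
rewrite /spanning bigcap_imset_eq0 bigcup_imset_eqT m0 j1 !andbT.
by apply/ffun_onP => i; rewrite inE fk.
Qed.

Lemma beta0_layer_lower r n k : r <= 'C(n, k) ->
  #|@meet_tuples r n (fun=> k)| <= 3 ^ r * r`! * beta0 r (layer n k).
Proof.
rewrite -card_layer beta0E => lerC.
apply: leq_trans (tuples_in_lower (@no_common_mono n) lerC).
apply/subset_leq_card/subsetP => f; rewrite !inE => /andP[m0 /forallP fk].
rewrite /no_common bigcap_imset_eq0 m0 !andbT.
by apply/ffun_onP => i; rewrite inE fk.
Qed.

Lemma leq_exp2r_self m n r : m <= n -> m ^ r <= n ^ r.
Proof. by case: r => // r lemn; rewrite leq_exp2r. Qed.

(** Rests on 3 (m+1) <= (2m)^2; the factor [3 ^ r] prepays the loss in [gamma0_layer_lower]. *)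
Lemma regular_tuples_even r m : 0 < r -> 1 < m ->
  3 ^ r * (2 ^ r - 2) ^ (m + m) <= (m + m) ^ (2 * r) * #|regular_tuples r (m + m) m|.
Proof.
move=> r_gt0 m_gt1; apply: leq_trans (leq_mul (leqnn _) (regular_tuples_half m
  r_gt0)) _.
rewrite mulnA leq_mul2r -expnMn expnM leq_exp2r_self ?orbT //.
by rewrite -mulnn; nia.
Qed.

(** No other integer than 25 serves: at r = 3 this reads 46656 <= 46875, which fails with 24, and
    [regular_tuples_odd] uses 25 (m+1) <= 2 (2m+3)^2, an equality at m = 1. *)
Lemma surjection_bound r : 2 < r ->
  6 ^ r * (2 ^ r - 2) ^ 3 <= 25 ^ r * (3 ^ r - 3 * 2 ^ r).
Proof.
move=> r_gt2; have [->|r_gt3] : r = 3 \/ 3 < r by lia.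
  lia.
(* For r > 3 at least a third of all maps is left, and 3 * 48^r <= 75^r suffices. *)
have surj : 3 ^ r <= 3 * (3 ^ r - 3 * 2 ^ r).
  suff : 9 * 2 ^ r <= 2 * 3 ^ r by lia.
  rewrite -(subnKC r_gt3) !expnD mulnA [leqRHS]mulnA.
  by apply: leq_mul => //; apply: leq_exp2r_self.
rewrite -(@leq_pmul2l 3) // [leqRHS]mulnCA.
apply: leq_trans _ (leq_mul (leqnn _) surj); rewrite -expnMn.
apply: (@leq_trans (3 * 48 ^ r)).
  rewrite leq_mul2l (_ : 48 = 6 * 8) // expnMn leq_mul2l -[8]/(2 ^ 3) -expnM.
  by rewrite mulnC expnM leq_exp2r_self ?leq_subr ?orbT.
rewrite -(subnKC r_gt3) !expnD mulnA; apply: leq_mul; last exact: leq_exp2r_self.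
lia.
Qed.

(** The first 2m points carry sets of size m, the last three carry singletons. *)
Lemma regular_tuples_odd r m : 2 < r -> 0 < m ->
  3 ^ r * (2 ^ r - 2) ^ (m + m + 3)
    <= (m + m + 3) ^ (2 * r) * #|regular_tuples r (m + m + 3) (m + 1)|.
Proof.
move=> r_gt2 m_gt0; have r_gt0 : 0 < r by lia.
apply: leq_trans (leq_mul (leqnn _) (regular_tuples_glue _ _ _ _ _)).
rewrite expnD; apply: leq_trans (leq_mul (leqnn _)
  (leq_mul (regular_tuples_half m r_gt0) (leqnn _))) _.
set Q := #|regular_tuples r (m + m) m|; set S := #|regular_tuples r 3 1|.
have leS : 6 ^ r * (2 ^ r - 2) ^ 3 <= 25 ^ r * S.
  apply: leq_trans (surjection_bound r_gt2) _; rewrite leq_mul2l.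
  by rewrite regular_tuples_3 ?orbT //; lia.
have len : 25 * m.+1 <= 2 * (m + m + 3) ^ 2 by rewrite -mulnn; nia.
(* The additional 2^r turns 3^r into the 6^r of [surjection_bound]. *)
rewrite -(@leq_pmul2l (2 ^ r)) ?expn_gt0 //.
have -> : 2 ^ r * (3 ^ r * (m.+1 ^ r * Q * (2 ^ r - 2) ^ 3))
          = m.+1 ^ r * Q * (6 ^ r * (2 ^ r - 2) ^ 3).
  by rewrite (_ : 6 = 2 * 3) // expnMn; lia.
apply: leq_trans (leq_mul (leqnn _) leS) _.
have -> : m.+1 ^ r * Q * (25 ^ r * S) = (25 * m.+1) ^ r * (Q * S).
  by rewrite expnMn; lia.
by rewrite [leqRHS]mulnA leq_mul2r expnM -expnMn leq_exp2r_self ?orbT.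
Qed.

Lemma middle_layer_lower r n : 2 < r -> 3 < n -> r <= 'C(n, n./2) ->
  (2 ^ r - 2) ^ n <= n ^ (2 * r) * (r`! * gamma0 r (layer n n./2)).
Proof.
move=> r_gt2 n_gt3 lerC; rewrite -(@leq_pmul2l (3 ^ r)) ?expn_gt0 //.
rewrite mulnCA [3 ^ r * (r`! * _)]mulnA.
apply: leq_trans (leq_mul (leqnn _) (gamma0_layer_lower lerC)).
have [oddn|evenn] := boolP (odd n).
  have [m en] : exists m, n = m + m + 3 by exists (n - 3)./2; lia.
  subst n; rewrite (_ : (m + m + 3)./2 = m + 1); last by lia.
  by apply: regular_tuples_odd; lia.
have [m en] : exists m, n = m + m by exists n./2; lia.
subst n; rewrite addnn doubleK -addnn.
by apply: regular_tuples_even; lia.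
Qed.

Lemma card_tuples_in_le (X : finType) r (P : pred {set X}) (F : {set X}) :
  #|tuples_in r P F| <= 'C(#|F|, r).
Proof.
rewrite -cards_draws; apply/subset_leq_card/subsetP => T.
by rewrite !inE => /and3P[-> ->].
Qed.

Lemma card_antichain n (F : {set {set 'I_n}}) : antichain F -> #|F| <= 'C(n, n./2).
Proof. by move/card_sperner; rewrite card_ord. Qed.

(** Serves n = 3, which lies below the range of [middle_layer_lower]. *)
Lemma middle_layer_3 : gamma0 3 (layer 3 1) = 1.
Proof.
have cardL : #|layer 3 1| = 3 by rewrite card_layer.
rewrite gamma0E (_ : tuples_in 3 _ _ = [set layer 3 1]) ?cards1 //.
apply/setP => T; rewrite !inE; apply/and3P/eqP => [[sub /eqP cT _]|->].
  by apply/eqP; rewrite eqEcard sub cardL cT.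
rewrite subxx cardL /spanning; split=> //; apply/andP; split.
  rewrite -subset0; apply/subsetP => j /bigcapP/(_ [set if j == ord0 then ord_max
    else ord0]).
  by rewrite !inE cards1 => /(_ isT); case: (j =P ord0) => [->|/eqP] // => /negPf->.
rewrite eqEsubset subsetT; apply/subsetP => j _; apply/bigcupP.
by exists [set j]; rewrite !inE ?cards1.
Qed.

Lemma few_tuples_3 r P (F : {set {set 'I_3}}) : 2 < r -> antichain F ->
  #|tuples_in r P F| <= gamma0 r (layer 3 3./2).
Proof.
move=> r_gt2 acF; apply: leq_trans (card_tuples_in_le _ _ _) _.
have le3 : #|F| <= 3 by apply: card_antichain.
have [->|r_gt3] : r = 3 \/ 3 < r by lia.
  by rewrite [3./2]/= middle_layer_3; apply: leq_trans (leq_bin2l 3 le3) _.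
by rewrite bin_small //; apply: leq_ltn_trans r_gt3.
Qed.

Lemma no_tuples r n P (F : {set {set 'I_n}}) : 'C(n, n./2) < r -> antichain F ->
  #|tuples_in r P F| = 0.
Proof.
move=> ltCr /card_antichain leF; apply/eqP; rewrite -leqn0.
apply: leq_trans (card_tuples_in_le _ _ _) _.
by rewrite bin_small // (leq_ltn_trans leF).
Qed.

Lemma gamma0_ge3 r n (F : {set {set 'I_n}}) : 2 < r -> antichain F ->
  gamma0 r F <= n ^ (2 * r) * gamma0 r (layer n n./2).
Proof.
move=> r_gt2 acF; case: (leqP r 'C(n, n./2)) => [lerC|ltCr]; last first.
  by rewrite gamma0E no_tuples.
case: (leqP n 3) => [|n_gt3].
  (* For n at most 2 the middle layer has fewer than three sets, against [lerC]. *)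
  case: n F acF lerC => [|[|[|[|//]]]] F acF lerC;
    try by move: (leq_trans r_gt2 lerC).
  move=> _; apply: leq_trans (few_tuples_3 _ r_gt2 acF) _.
  by rewrite leq_pmull // expn_gt0.
rewrite -(@leq_pmul2l r`!) ?fact_gt0 // mulnCA.
by apply: leq_trans (gamma0_upper _ _) (middle_layer_lower r_gt2 n_gt3 lerC); lia.
Qed.

Lemma beta0_many r n (F : {set {set 'I_n}}) : 2 < r -> n <= 2 ^ r - 2 ->
  antichain F -> beta0 r F <= n ^ (2 * r + 1) * beta0 r (layer n n./2).
Proof.
move=> r_gt2 len acF; case: (leqP r 'C(n, n./2)) => [lerC|ltCr]; last first.
  by rewrite beta0E no_tuples.
case: (leqP n 3) => [|n_gt3].
  case: n F acF lerC len => [|[|[|[|//]]]] F acF lerC len;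
    try by move: (leq_trans r_gt2 lerC).
  move=> _; apply: leq_trans (few_tuples_3 _ r_gt2 acF) _.
  by rewrite (leq_trans (gamma0_le_beta0 _ _)) // leq_pmull // expn_gt0.
rewrite -(@leq_pmul2l r`!) ?fact_gt0 // mulnCA.
apply: leq_trans (beta0_upper _ _) _.
have -> : (2 ^ r).-1 = (2 ^ r - 2).+1.
  by have := leq_pexp2l (isT : 0 < 2) r_gt2; lia.
(* Since n is at most 2^r - 2, admitting one more type costs only a factor 3, which the extra power
   of n absorbs. *)
apply: leq_trans (expSn_le3 len) _; rewrite expnD expn1 [_ * n]mulnC -mulnA.
apply: leq_mul; first by lia.
apply: leq_trans (middle_layer_lower r_gt2 n_gt3 lerC) _.
by rewrite !leq_mul2l gamma0_le_beta0 !orbT.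
Qed.

(** Ensures that for large n every inner layer has at least r members, as [beta0_layer_lower]
    requires. *)
Lemma bin_ge_n n l : 0 < l < n -> n <= 'C(n, l).
Proof.
elim: n l => // n IHn [//|l] /= ltln; rewrite binS -addn1.
have [<-|ne] := eqVneq l.+1 n; first by rewrite binn binSn addnC.
by rewrite leq_add ?bin_gt0 ?IHn //; lia.
Qed.

Lemma antichain_size n (F : {set {set 'I_n}}) (A B : {set 'I_n}) :
  antichain F -> A \in F -> B \in F -> A != B -> 0 < #|A| < n.
Proof.
move=> acF FA FB neqAB; apply/andP; split.
  rewrite lt0n cards_eq0; apply/eqP => A0; have := acF A B FA FB.
  by rewrite A0 proper0 negbK eq_sym -A0 (negPf neqAB).
rewrite -[ltnRHS](card_ord n) ltn_neqAle max_card andbT; apply/negP => cA.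
have /eqP AT : A == setT by rewrite eqEcard subsetT cardsT (eqP cA) /=.
by have := acF B A FB FA; rewrite AT properT negbK eq_sym -AT (negPf neqAB).
Qed.

(** There are (n-1)^r size profiles; balancing costs n^(r-1) and repetitions cost 3^r, which is at
    most n^2 as n >= 2^r - 1. The exponents add up to 2r + 1. *)
Lemma beta0_few r n (F : {set {set 'I_n}}) : 2 < r -> 2 ^ r - 2 < n ->
  antichain F ->
  beta0 r F <= n ^ (2 * r + 1) * \max_(l < n.+1) beta0 r (layer n l).
Proof.
move=> r_gt2 ltn acF; set M := \max_(l < n.+1) _; have r_gt0 : 0 < r by lia.
have pow r' : 2 < r' -> 3 ^ r' <= (2 ^ r').-1 ^ 2.
  move=> r'_gt2; rewrite -(subnKC r'_gt2); elim: (r' - 3) => // d IHd.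
  rewrite addnS !expnS expn0 muln1 in IHd *; have := expn_gt0 2 (3 + d).
  set y := 2 ^ _ in IHd *; nia.
have n1_gt0 : 0 < n.-1 by have := leq_pexp2l (isT : 0 < 2) r_gt2; lia.
pose S := [set f : {ffun 'I_r -> {set 'I_n}} |
   [&& f \in ffun_on F, injectiveb f & no_common (f @: setT)]].
rewrite -(@leq_pmul2l r`!) ?fact_gt0 // beta0E tuples_in_upper -/S.
have sizeS f i : f \in S -> 0 < #|f i| < n.
  rewrite inE => /and3P[/ffun_onP fF /injectiveP inj_f _].
  (* Any other index: a second member of the antichain excludes the empty and the full set. *)
  pose j : 'I_r := if i == Ordinal r_gt0 then Ordinal (ltnW r_gt2) else Ordinal r_gt0.
  apply: (antichain_size acF (fF i) (fF j)); rewrite (inj_eq inj_f) /j.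
  by case: (eqVneq i (Ordinal r_gt0)) => [->|].
have prof (k : {ffun 'I_r -> 'I_n.-1}) :
    #|@meet_tuples r n (fun i => (k i).+1)| <= n ^ r.-1 * (3 ^ r * r`! * M).
  have [|l ln] := leq_meet_tuples_balanced r_gt0 (k := fun i => (k i).+1) (n := n).
    by move=> i; have := ltn_ord (k i); lia.
  move=> /leq_trans; apply; rewrite leq_mul2l; apply/orP; right.
  have lerC : r <= 'C(n, l).
    by apply: leq_trans (bin_ge_n ln); have := ltn_expl r (isT : 1 < 2); lia.
  apply: leq_trans (beta0_layer_lower lerC) _; rewrite leq_mul2l; apply/orP; right.
  have ltl : l < n.+1 by lia.
  exact: (leq_bigmax (Ordinal ltl)).
have -> : #|S| = \sum_(k : {ffun 'I_r -> 'I_n.-1}) #|[set f in S | [forall i, #|f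
  i| == (k i).+1]]|.
  (* Sizes 1, ..., n-1 are stored as 0, ..., n-2; [sizeS] keeps [insubd] off its default on [S]. *)
  pose h (f : {ffun 'I_r -> {set 'I_n}}) : {ffun 'I_r -> 'I_n.-1} :=
    [ffun i => insubd (Ordinal n1_gt0) #|f i|.-1].
  rewrite -sum1_card (partition_big h predT) //; apply: eq_bigr => k _.
  rewrite -sum1_card; apply: eq_bigl => f; rewrite [RHS]inE.
  case: (boolP (f \in S)) => //= Sf; apply/eqP/forallP => [<- i|fk].
    have := sizeS f i Sf; rewrite ffunE insubdK => [lt|]; first by rewrite prednK;
      case/andP: lt.
    by have /andP[c0 cn] := sizeS f i Sf; rewrite unfold_in ltn_predRL prednK.
  apply/ffunP => i; apply: val_inj; rewrite ffunE (eqP (fk i)) insubdK //.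
  by rewrite unfold_in /=.
apply: (@leq_trans (n.-1 ^ r * (n ^ r.-1 * (3 ^ r * r`! * M)))).
  have <- : #|{ffun 'I_r -> 'I_n.-1}| = n.-1 ^ r by rewrite card_ffun !card_ord.
  rewrite -sum_nat_const; apply: leq_sum => k _; apply: leq_trans (prof k).
  apply/subset_leq_card/subsetP => f; rewrite !inE => /andP[/and3P[_ _]].
  by rewrite /no_common bigcap_imset_eq0 => -> ->.
have le3 : 3 ^ r <= n ^ 2.
  by apply: leq_trans (pow r r_gt2) _; rewrite leq_exp2r_self //; lia.
have -> : 2 * r + 1 = r + r.-1 + 2 by lia.
rewrite (expnD n (r + r.-1)) (expnD n r) [r`! * _]mulnCA -!mulnA; apply: leq_mul.
  by rewrite leq_exp2r_self // leq_pred.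
by rewrite leq_mul2l [n * (n * _)]mulnA mulnn leq_mul2r le3 !orbT.
Qed.

Lemma beta0_ge3 r n (F : {set {set 'I_n}}) : 2 < r -> antichain F ->
  beta0 r F <= n ^ (2 * r + 1) * \max_(l < n.+1) beta0 r (layer n l).
Proof.
move=> r_gt2 acF; case: (leqP n (2 ^ r - 2)) => len; last exact: beta0_few.
apply: leq_trans (beta0_many r_gt2 len acF) _; rewrite leq_mul2l; apply/orP; right.
have lth : n./2 < n.+1 by lia.
exact: (leq_bigmax (Ordinal lth)).
Qed.

(** * Pairs *)

Lemma card_pairs (X : finType) (P : pred {set X}) (F : {set X}) :
  2 * #|tuples_in 2 P F|
  = #|[set x : X * X | [&& x.1 \in F, x.2 \in F, x.1 != x.2 & P [set x.1; x.2]]]|.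
Proof.
rewrite (tuples_in_upper 2).
pose h (f : {ffun 'I_2 -> X}) := (f ord0, f ord_max).
have ord2 (i : 'I_2) : i = ord0 \/ i = ord_max.
  by case: i => [[|[|//]] ?]; [left|right]; apply: val_inj.
have inj_h : injective h.
  by move=> f g [eq0 eq1]; apply/ffunP => i; case: (ord2 i) => ->.
have im (f : {ffun 'I_2 -> X}) : f @: setT = [set f ord0; f ord_max].
  apply/setP => x; rewrite !inE; apply/imsetP/orP => [[i _ ->]|[] /eqP->].
  - by case: (ord2 i) => ->; rewrite eqxx; [left|right].
  - by exists ord0.
  by exists ord_max.
rewrite -(card_imset _ inj_h); apply: eq_card => -[x y]; rewrite inE /=.
apply/imsetP/and4P => [[f + [-> ->]]|[Fx Fy neqxy Pxy]].
  rewrite inE im => /and3P[/ffun_onP fF /injectiveP inj_f Pf]; split=> //.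
  by rewrite (inj_eq inj_f).
pose f := [ffun i : 'I_2 => if i == ord0 then x else y].
have f0 : f ord0 = x by rewrite ffunE eqxx.
have f1 : f ord_max = y by rewrite ffunE.
exists f; last by rewrite /h f0 f1.
rewrite inE im f0 f1 Pxy andbT; apply/andP; split.
  by apply/ffun_onP => i; case: (ord2 i) => ->; rewrite ?f0 ?f1.
apply/injectiveP => i j; case: (ord2 i) => ->; case: (ord2 j) => -> //;
  by rewrite f0 f1 => /eqP; rewrite ?[y == x]eq_sym (negPf neqxy).
Qed.

Lemma no_common2 n (A B : {set 'I_n}) : no_common [set A; B] = (B \subset ~: A).
Proof.
rewrite /no_common; have [->|neqAB] := eqVneq A B.
  by rewrite setUid big_set1 -disjoints_subset -setI_eq0 setIid.
by rewrite big_setU1 ?inE //= big_set1 -disjoints_subset setI_eq0 disjoint_sym.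
Qed.

Lemma sum_card_pairs (X Y : finType) (A : {set X}) (E : X -> Y -> bool) :
  #|[set x : X * Y | (x.1 \in A) && E x.1 x.2]| = \sum_(a in A) #|[set b | E a b]|.
Proof.
rewrite -sum1_card (eq_bigl (fun x : X * Y => (x.1 \in A) && E x.1 x.2)).
  rewrite -(pair_big_dep (mem A) E (fun _ _ => 1)) /=; apply: eq_bigr => a _.
  by rewrite sum1dep_card.
by move=> x; rewrite inE.
Qed.

(** n! divided by the factorials of three nearly equal parts, that is, the largest trinomial
    coefficient. *)
Definition trinomial_max n := 'C(n, n %/ 3) * 'C(n - n %/ 3, (n - n %/ 3)./2).

Lemma bin_bin_fact n a b : a + b <= n ->
  'C(n, a) * 'C(n - a, b) * (a`! * b`! * (n - a - b)`!) = n`!.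
Proof.
move=> le_ab; rewrite -[RHS](bin_fact (_ : a <= n)); last by lia.
by rewrite -(bin_fact (_ : b <= n - a)); lia.
Qed.

(** [fact_line] with q = floor(n/3) is multiplied over the three parts a, b, c. The resulting bound
    q!^3 (q+1)^(n-3q) is the product of the factorials of the balanced parts. *)
Lemma trinomial_maxP n a : a <= n ->
  'C(n, a) * 'C(n - a, (n - a)./2) <= trinomial_max n.
Proof.
move=> lean; rewrite /trinomial_max; set q := n %/ 3; set b := (n - a)./2.
set c := n - a - b; have leab : a + b <= n by rewrite /b; lia.
set b' := (n - q)./2; have leqb : q + b' <= n by rewrite /b' /q; lia.
have := bin_bin_fact leqb; rewrite -(bin_bin_fact leab) -/c => eqn.
have fact_gt0' : 0 < a`! * b`! * c`! by rewrite !muln_gt0 !fact_gt0.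
rewrite -(@leq_pmul2r (a`! * b`! * c`!)) // -eqn leq_mul2l; apply/orP; right.
rewrite -(@leq_pmul2r (q.+1 ^ (q + q + q))) ?expn_gt0 //.
have := leq_mul (leq_mul (fact_line q a) (fact_line q b)) (fact_line q c).
rewrite (_ : a`! * _ * _ * _ = a`! * b`! * c`! * q.+1 ^ (q + q + q)); last first.
  by rewrite !expnD; move: (q.+1 ^ q) => z; lia.
apply: leq_trans; rewrite (_ : q`! * q.+1 ^ a * (q`! * q.+1 ^ b) * (q`! * q.+1 ^ c)
    = q`! * q`! * q`! * q.+1 ^ n); last first.
  have -> : n = a + b + c by rewrite /c; lia.
  by rewrite !expnD; move: (q.+1 ^ a) (q.+1 ^ b) (q.+1 ^ c) => x y z; lia.
have n3 : n = 3 * q + n %% 3 by rewrite mulnC -divn_eq.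
have lt3 : n %% 3 < 3 by rewrite ltn_mod.
have [n0|[n1|n2]] : n %% 3 = 0 \/ n %% 3 = 1 \/ n %% 3 = 2 by lia.
- have -> : b' = q by rewrite /b'; lia.
  have -> : n - q - q = q by lia.
  by have -> : n = q + q + q by lia.
- have -> : b' = q by rewrite /b'; lia.
  have -> : n - q - q = q.+1 by lia.
  have -> : n = (q + q + q).+1 by lia.
  by rewrite factS expnS; lia.
have -> : b' = q.+1 by rewrite /b'; lia.
have -> : n - q - q.+1 = q.+1 by lia.
have -> : n = (q + q + q).+2 by lia.
by rewrite factS !expnS; lia.
Qed.

(** After multiplication by n! = C(n,|A|) |A|! (n-|A|)!, [trinomial_maxP] bounds the binomials for
    each [A], and the remaining factorials sum to at most n! by [lym]. *)
Lemma beta0_2_le n (F : {set {set 'I_n}}) : antichain F ->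
  2 * beta0 2 F <= trinomial_max n.
Proof.
move=> acF; rewrite beta0E card_pairs.
apply: (@leq_trans (\sum_(A in F) #|[set B in F | B \subset ~: A]|)).
  rewrite -sum_card_pairs; apply/subset_leq_card/subsetP => -[A B].
  by rewrite !inE /= no_common2 => /and4P[-> -> _ ->].
rewrite -(@leq_pmul2r n`!) ?fact_gt0 //.
have := lym acF; rewrite card_ord => lymF.
apply: leq_trans (leq_mul (leqnn (trinomial_max n)) lymF).
rewrite big_distrl big_distrr /=; apply: leq_sum => A FA.
have leA : #|A| <= n by rewrite -[leqRHS](card_ord n) max_card.
apply: (@leq_trans ('C(n - #|A|, (n - #|A|)./2) * n`!)).
  rewrite leq_mul2r; apply/orP; right.
  have <- : #|~: A| = n - #|A| by rewrite cardsCs setCK card_ord.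
  apply: card_sperner_in => [B|B C]; first by rewrite inE => /andP[].
  by rewrite !inE => /andP[FB _] /andP[FC _]; apply: acF.
rewrite -(bin_fact leA) mulnA leq_mul2r [X in X <= _]mulnC trinomial_maxP //.
by rewrite orbT.
Qed.

(** Disjoint sets of positive size are different, so one chooses [A] and then any [B] in its
    complement. *)
Lemma beta0_2_layer n k : 0 < k ->
  2 * beta0 2 (layer n k) = 'C(n, k) * 'C(n - k, k).
Proof.
move=> k_gt0; rewrite beta0E card_pairs -card_layer -sum_nat_const.
transitivity (\sum_(A in layer n k) #|[set B : {set 'I_n} | (B \subset ~: A) &&
  (#|B| == k)]|).
  rewrite -sum_card_pairs; apply: eq_card => -[A B]; rewrite !inE /= no_common2.
  apply/and4P/and3P => [[-> -> _ ->] //|[cA sub cB]]; split=> //.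
  apply/eqP => eqAB; move: sub.
  by rewrite -eqAB -disjoints_subset -setI_eq0 setIid -cards_eq0 (eqP cA) gtn_eqF.
apply: eq_bigr => A; rewrite inE => /eqP cA; rewrite cards_draws.
by rewrite cardsCs setCK card_ord cA.
Qed.

Lemma antichain_layer n k : antichain (layer n k).
Proof.
move=> A B; rewrite !inE => /eqP cA /eqP cB.
by apply/negP => /proper_card; rewrite cA cB ltnn.
Qed.

(** * Complementary pairs *)

Lemma spanning2 n (A B : {set 'I_n}) : spanning [set A; B] = (B == ~: A).
Proof.
rewrite /spanning -/(no_common _) no_common2 bigcup_setU !big_set1.
apply/andP/eqP => [[sub /eqP cup]|->]; last by rewrite subxx setUCr.
apply/eqP; rewrite eqEsubset sub; apply/subsetP => x; rewrite inE => /negPf nA.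
by have := in_setT x; rewrite -cup inE nA.
Qed.

Lemma gamma0_2E n (F : {set {set 'I_n}}) :
  2 * gamma0 2 F = #|[set A in F | (~: A \in F) && (A != ~: A)]|.
Proof.
rewrite gamma0E card_pairs -(card_imset (f := fun A => (A, ~: A))) => [|A B [] //].
apply: eq_card => -[A B]; rewrite !inE /= spanning2; apply/and4P/imsetP.
  by case=> FA FB neq /eqP eqB; exists A; rewrite -?eqB // inE -eqB FA FB.
by case=> C + [-> ->]; rewrite inE => /and3P[FC FC' neq].
Qed.

(** Twice the count is at most #|F|, which Sperner bounds; in the middle layer every set is paired,
    except on the empty ground set, where a set equals its complement. *)
Lemma gamma0_2_even n (F : {set {set 'I_n}}) : ~~ odd n -> antichain F ->
  gamma0 2 F <= gamma0 2 (layer n n./2).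
Proof.
move=> evenn acF; rewrite -(@leq_pmul2l 2) // !gamma0_2E.
case: (posnP n) => [n0|n_gt0].
  suff -> : [set A in F | (~: A \in F) && (A != ~: A)] = set0 by rewrite cards0.
  subst n; apply/setP => A; rewrite !inE (_ : A == ~: A) ?andbF //.
  by apply/eqP/setP => -[].
apply: (@leq_trans #|F|).
  by apply/subset_leq_card/subsetP => A; rewrite inE => /andP[].
apply: leq_trans (card_antichain acF) _; rewrite -card_layer.
apply/subset_leq_card/subsetP => A; rewrite !inE => /eqP cA.
have cA' : #|~: A| = n./2 by rewrite cardsCs setCK card_ord; lia.
rewrite cA cA' !eqxx /=; apply/eqP => /setP/(_ (Ordinal n_gt0)).
by rewrite inE; case: (_ \in A).
Qed.

(** * Complement-closed antichains on a circle *)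

Section Circle.
Variable n : nat.
Implicit Types (i j e : 'I_n) (a : nat) (G : {set {set 'I_n}}).

(** Number of steps from [i] to [j] in the positive direction of the cycle. *)
Definition dist i j := if i <= j then j - i else j + n - i.

Definition circle_arc i a := [set j | dist i j < a].

Lemma card_arc i a : a <= n -> #|circle_arc i a| = a.
Proof.
move=> lean; have n_gt0 : 0 < n by case: (n) i => [[]|].
pose e (t : 'I_a) := insubd i (if i + t < n then i + t else i + t - n).
have valE t : val (e t) = if i + t < n then i + t else i + t - n.
  by rewrite insubdK // unfold_in; have := ltn_ord i; have := ltn_ord t;
    case: (ltnP (i + t) n); lia.
have distE t : dist i (e t) = t.
  have := ltn_ord i; have := ltn_ord t; rewrite /dist valE.
  by case: (ltnP (i + t) n) => ?; case: (leqP i _); lia.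
rewrite -[RHS]card_ord -(card_imset (f := e)) => [|t t' eqe]; last first.
  by apply: val_inj; rewrite /= -[LHS]distE eqe distE.
apply: eq_card => j; rewrite inE; apply/idP/imsetP => [lta|[t _ ->]]; last first.
  by rewrite distE.
exists (Ordinal lta) => //; apply: val_inj; rewrite /= valE /= /dist.
have := ltn_ord i; have := ltn_ord j; case: (leqP i j) => ?.
  by rewrite subnKC // ltn_ord.
by case: (ltnP (i + _) n); lia.
Qed.

Lemma arc_sub i a b : a <= b -> circle_arc i a \subset circle_arc i b.
Proof. by move=> leab; apply/subsetP => j; rewrite !inE => /leq_trans; apply. Qed.

(** First point after the arc, where the complementary arc starts; the default of [insubd] is not
    reached for a <= n. *)
Definition endpoint i a := insubd i (if i + a < n then i + a else i + a - n).

Lemma endpointE i a : a <= n ->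
  endpoint i a = (if i + a < n then i + a else i + a - n) :> nat.
Proof.
by move=> lean; rewrite insubdK // unfold_in; have := ltn_ord i;
  case: (ltnP (i + a) n); lia.
Qed.

Lemma arcC i a : 0 < a <= n -> ~: circle_arc i a = circle_arc (endpoint i a) (n - a).
Proof.
move=> /andP[a_gt0 lean]; apply/setP => j; rewrite !inE /dist endpointE //.
have lti := ltn_ord i; have ltj := ltn_ord j.
by case: (leqP i j) => ?; case: (ltnP (i + a) n) => ?; case: (leqP _ j) => ? /=; lia.
Qed.

Lemma arc_start_inj G i a b : antichain G -> a <= n -> b <= n ->
  circle_arc i a \in G -> circle_arc i b \in G -> a = b.
Proof.
move=> acG; wlog leab : a b / a <= b => [wl lean lebn Ga Gb|].
  by case: (leqP a b) => [|/ltnW] le; [|symmetry]; apply: wl.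
move=> lean lebn Ga Gb; apply/eqP; rewrite eqn_leq leab leqNgt; apply/negP => ltab.
by have := acG _ _ Ga Gb; rewrite properEcard arc_sub // !card_arc // ltab.
Qed.

Hypothesis n_odd : odd n.

(** Arcs are stored by start and length. As n is odd, the bound selects one of any two complementary
    proper nonempty arcs. *)
Definition short_arcs G :=
  [set x : 'I_n * 'I_n.+1 | [&& 0 < x.2, x.2 <= n./2 & circle_arc x.1 x.2 \in G]].

(* Any two complementary pairs of arcs in G have crossing endpoints, so that
   each of the other pairs has exactly one endpoint inside a given short arc. *)
Lemma card_arcs_le G : antichain G -> {in G, forall A : {set 'I_n}, ~: A \in G} ->
  forall x, x \in short_arcs G -> #|short_arcs G| <= x.2.
Proof.
move=> acG compG [i0 [a0 lta0]]; rewrite inE /= => /and3P[a0_gt0 a0_half G0].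
(* An endpoint lying in the given arc, the start being preferred; [in_arc] shows that there is
   one. *)
pose mark (x : 'I_n * 'I_n.+1) :=
  if dist i0 x.1 < a0 then x.1 else endpoint x.1 x.2.
have arcCE i a : 0 < a <= n./2 -> circle_arc i a \in G ->
    circle_arc (endpoint i a) (n - a) \in G.
  by move=> /andP[a_gt0 lea] Ga; rewrite -arcC ?compG // a_gt0 /=; lia.
have in_arc x : x \in short_arcs G -> mark x \in circle_arc i0 a0.
  case: x => i [a lta]; rewrite inE /mark /= => /and3P[a_gt0 a_half Ga].
  case: ifP => [|/negbT]; rewrite inE // -leqNgt => lei; rewrite ltnNge.
  apply/negP => lee; have lean : a <= n by [].
  have Gc := arcCE i a; rewrite a_gt0 a_half Ga in Gc; have {Gc} := Gc isT isT.
  have lti := ltn_ord i; have lti0 := ltn_ord i0.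
  case: (ltnP (dist i0 i) (dist i0 (endpoint i a))) => [ltd|led] Gc.
    (* Read from [i0], the start precedes the end: the given arc avoids this one and lies properly
       in its complement. *)
    have := acG _ _ G0 Gc; rewrite properEcard !card_arc; try lia.
    rewrite (_ : a0 < n - a) ?andbT; last by lia.
    move/negP; apply; rewrite -arcC ?a_gt0 //; apply/subsetP => j;
      rewrite !inE -leqNgt.
    move: lei lee ltd; rewrite /dist endpointE //; have ltj := ltn_ord j.
    by case: (ltnP (i + a) n) => ?; case: (leqP i0 i) => ?; case: (leqP i0 j) => ?;
      case: (leqP i j) => ?; case: (leqP i0 _) => ?; lia.
  (* Otherwise this arc wraps around and properly contains the given one. *)
  have := acG _ _ G0 Ga; rewrite properEcard !card_arc; try lia.
  have -> : a0 < a.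
    move: lei lee led; rewrite /dist endpointE //.
    by case: (ltnP (i + a) n) => ?; case: (leqP i0 i) => ?;
      case: (leqP i0 _) => ?; lia.
  rewrite andbT => /negP; apply; apply/subsetP => j; rewrite !inE.
  move: lei lee led; rewrite /dist endpointE //; have ltj := ltn_ord j.
  by case: (ltnP (i + a) n) => ?; case: (leqP i0 i) => ?; case: (leqP i0 j) => ?;
    case: (leqP i j) => ?; case: (leqP i0 _) => ?; lia.
(* At a mark starts an arc of [G], the short one or its complement. Arcs of [G] with equal starts
   have equal lengths, and a length up to n/2 never equals one above n/2. *)
have inj_mark : {in short_arcs G &, injective mark}.
  move=> [i [a lta]] [j [b ltb]]; rewrite !inE /mark /=.
  move=> /and3P[a_gt0 a_half Ga] /and3P[b_gt0 b_half Gb].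
  have Gca := arcCE i a; rewrite a_gt0 a_half Ga in Gca; have {}Gca := Gca isT isT.
  have Gcb := arcCE j b; rewrite b_gt0 b_half Gb in Gcb; have {}Gcb := Gcb isT isT.
  case: ifP => _; case: ifP => _ eqij.
  - move: Gb; rewrite -eqij => Gb; have eqab := arc_start_inj acG lta ltb Ga Gb.
    by congr pair; apply: val_inj.
  - by rewrite -eqij in Gcb; have := arc_start_inj acG lta (leq_subr _ _) Ga Gcb; lia.
  - by rewrite eqij in Gca; have := arc_start_inj acG ltb (leq_subr _ _) Gb Gca; lia.
  rewrite -eqij in Gcb;
    have eqab := arc_start_inj acG (leq_subr _ _) (leq_subr _ _) Gca Gcb.
  have {}eqab : a = b by lia.
  congr pair; last exact: val_inj.
  have := congr1 val eqij; rewrite /= !endpointE -?eqab; try lia.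
  have lti := ltn_ord i; have ltj := ltn_ord j => eqe; apply: val_inj => /=.
  by move: eqe; case: (ltnP (i + a) n) => ?; case: (ltnP (j + a) n) => ?; lia.
rewrite -[a0](@card_arc i0) // -(card_in_imset inj_mark).
by apply/subset_leq_card/subsetP => _ /imsetP[x xG ->]; apply: in_arc.
Qed.

End Circle.

(** * Averaging over cyclic orders *)

Lemma fact_mul_decr N j k : j <= k -> 2 * k <= N ->
  k`! * (N - k)`! <= j`! * (N - j)`!.
Proof.
move=> lejk; rewrite -(subnKC lejk); elim: (k - j) => [|d IHd];
  first by rewrite addn0.
move=> le2; apply: leq_trans (IHd _); last by lia.
rewrite addnS factS (_ : N - (j + d) = (N - (j + d).+1).+1); last by lia.
by rewrite factS mulnA [_`! * _]mulnC leq_mul2r leq_mul2r; apply/orP; right;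
  apply/orP; right; lia.
Qed.

(** A short arc of length a has weight m!/a, an integer as a <= m. In each cyclic order s arcs
    occur, each of length at least s, so their weights sum to at most m!. Over all orders a set of
    size a receives n (m!/a) a! (n-a)!, which is at least n m! (m-1)! (n-m)!. *)
Lemma katona_complement n (G : {set {set 'I_n}}) : odd n -> 1 < n -> antichain G ->
  {in G, forall A : {set 'I_n}, ~: A \in G} ->
  #|[set A in G | #|A| <= n./2]| <= 'C(n.-1, n./2.-1).
Proof.
move=> oddn n_gt1 acG compG; set m := n./2.
have m_gt0 : 0 < m by rewrite /m; lia.
pose w a := m`! %/ a; pose Ga a := [set A in G | #|A| == a].
pose Gp (p : {perm 'I_n}) := [set B : {set 'I_n} | p @: B \in G].
have wsum p : \sum_(x in short_arcs (Gp p)) w x.2 <= m`!.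
  have acGp : antichain (Gp p).
    move=> A B; rewrite !inE => GA GB; apply: contra (acG _ _ GA GB).
    by apply: imset_proper; apply: in2W; apply: perm_inj.
  have compGp : {in Gp p, forall A : {set 'I_n}, ~: A \in Gp p}.
    move=> A; rewrite !inE => /compG; rewrite (_ : ~: _ = p @: ~: A) //.
    apply/setP => x; rewrite -[x](permKV p) inE !mem_imset ?inE //; exact: perm_inj.
  apply: (@leq_trans (#|short_arcs (Gp p)| * (m`! %/ #|short_arcs (Gp p)|)));
    last first.
    by rewrite mulnC leq_divM.
  rewrite -sum_nat_const; apply: leq_sum => x xG.
  have le := card_arcs_le oddn acGp compGp xG.
  by apply: leq_div2l => //; apply/card_gt0P; exists x.
have wbound a : 0 < a <= m -> w a * (#|Ga a| * (a`! * (n - a)`!))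
    >= #|Ga a| * (m`! * (m.-1`! * (n - m)`!)).
  move=> /andP[a_gt0 leam]; rewrite [leqRHS]mulnCA leq_mul2l; apply/orP; right.
  have wa : w a * a`! = m`! * a.-1`!.
    have -> : a`! = a * a.-1`! by rewrite -{1}(prednK a_gt0) factS prednK.
    by rewrite mulnA divnK // dvdn_fact // a_gt0.
  rewrite [leqRHS]mulnA wa -mulnA leq_mul2l; apply/orP; right.
  have := @fact_mul_decr n.-1 a.-1 m.-1.
  have -> : n.-1 - m.-1 = n - m by lia.
  have -> : n.-1 - a.-1 = n - a by lia.
  by apply; rewrite /m; lia.
have total : n * (#|[set A in G | #|A| <= m]| * (m`! * (m.-1`! * (n - m)`!)))
    <= n`! * m`!.
  apply: (@leq_trans (\sum_(p : {perm 'I_n}) \sum_(x in short_arcs (Gp p)) w x.2));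
    last first.
    have -> : n`! * m`! = \sum_(p : {perm 'I_n}) m`!.
      by rewrite sum_nat_const card_permT card_ord.
    by apply: leq_sum => p _; apply: wsum.
  rewrite (exchange_big_dep (fun x : 'I_n * 'I_n.+1 => 0 < x.2 <= m)) /=; last first.
    by move=> p x _; rewrite inE => /and3P[-> ->].
  have each (x : 'I_n * 'I_n.+1) : 0 < x.2 <= m ->
      \sum_(p : {perm 'I_n} | x \in short_arcs (Gp p)) w x.2
      = w x.2 * (#|Ga x.2| * (x.2`! * (n - x.2)`!)).
    move=> xm; have lexn : x.2 <= n by rewrite -ltnS.
    rewrite sum_nat_cond_const mulnC; congr (_ * _).
    have := @card_perm_imset _ (circle_arc x.1 x.2) (Ga x.2).
    rewrite card_arc // card_ord => <- => [|A]; last by rewrite inE => /andP[_ /eqP].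
    apply: eq_card => p; rewrite !inE andbA xm card_imset ?card_arc ?eqxx ?andbT //.
    exact: perm_inj.
  rewrite (eq_bigr _ each).
  rewrite -(pair_big_dep xpredT (fun _ (a : 'I_n.+1) => 0 < a <= m)
     (fun _ a => w a * (#|Ga a| * (a`! * (n - a)`!)))) /=.
  rewrite sum_nat_const card_ord leq_mul2l; apply/orP; right.
  have le : \sum_(a < n.+1 | 0 < a <= m) #|Ga a| * (m`! * (m.-1`! * (n - m)`!))
      <= \sum_(a < n.+1 | 0 < a <= m) w a * (#|Ga a| * (a`! * (n - a)`!)).
    by apply: leq_sum => a; apply: wbound.
  apply: leq_trans le; rewrite -big_distrl leq_mul2r; apply/orP; right => /=.
  rewrite -sum1_card (partition_big (fun A : {set 'I_n} => inord #|A| : 'I_n.+1)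
    (fun a => 0 < a <= m)) => [|A] /=.
    apply: leq_sum => a _; rewrite sum1dep_card; apply/subset_leq_card/subsetP => A.
    rewrite !inE => /andP[/andP[-> _] /eqP <-].
    by rewrite inordK ?eqxx // ltnS -[leqRHS](card_ord n) max_card.
  rewrite inE inordK; last by rewrite ltnS -[leqRHS](card_ord n) max_card.
  (* Size 0 is impossible: [G] would contain the empty set and the full set. *)
  move=> /andP[GA ->]; rewrite andbT lt0n cards_eq0; apply/eqP => A0.
  have := acG _ _ GA (compG _ GA); rewrite A0 setC0 properT negbK => /eqP/setP.
  by move=> /(_ (Ordinal (ltnW n_gt1))); rewrite !inE.
have c_gt0 : 0 < m.-1`! * (n - m)`! by rewrite muln_gt0 !fact_gt0.
have lemn : m.-1 <= n.-1 by rewrite /m; lia.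
rewrite -(@leq_pmul2r (m.-1`! * (n - m)`!)) //.
have <- : n.-1 - m.-1 = n - m by rewrite /m; lia.
rewrite bin_fact // (_ : n.-1 - m.-1 = n - m); last by rewrite /m; lia.
rewrite -(@leq_pmul2l n) // ?(ltnW n_gt1) //.
rewrite -(@leq_pmul2r m`!) ?fact_gt0 //.
have <- : n`! = n * n.-1`! by rewrite -{1}(prednK (ltnW n_gt1)) factS prednK // ltnW.
by apply: leq_trans total; rewrite [m`! * _]mulnC -!mulnA.
Qed.

(** Complementation sends the large members of [G] to small ones, so #|G| is at most twice the
    number bounded by [katona_complement]. *)
Lemma gamma0_2_odd n (F : {set {set 'I_n}}) : odd n -> antichain F ->
  gamma0 2 F <= binz n.-1 (n./2%:Z - 1)%R.
Proof.
move=> oddn acF; have [n1|n_gt1] : n = 1 \/ 1 < n by lia.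
  (* Here the lower index is -1, and the antichain has at most one member. *)
  suff -> : gamma0 2 F = 0 by [].
  by subst n; rewrite gamma0E no_tuples.
have -> : binz n.-1 (n./2%:Z - 1)%R = 'C(n.-1, n./2.-1).
  have : 0 < n./2 by lia.
  by case: n./2 => // k _; rewrite intS [(_ - 1)%R]addrC addKr.
pose G := [set A in F | ~: A \in F].
have acG : antichain G.
  by move=> A B; rewrite !inE => /andP[FA _] /andP[FB _]; apply: acF.
have compG : {in G, forall A : {set 'I_n}, ~: A \in G}.
  by move=> A; rewrite !inE setCK andbC.
apply: leq_trans (katona_complement oddn n_gt1 acG compG).
rewrite -(@leq_pmul2l 2) // gamma0_2E; apply: (@leq_trans #|G|).
  apply/subset_leq_card/subsetP => A; rewrite !inE => /and3P[-> ->] //.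
set S := [set A in G | _]; rewrite -(cardsID S G) mul2n -addnn leq_add //.
  exact/subset_leq_card/subsetIr.
rewrite -(card_imset _ (@setC_inj _));
  apply/subset_leq_card/subsetP => _ /imsetP[A + ->].
rewrite !inE setCK => /andP[+ /andP[FA FcA]]; rewrite FA FcA /= -ltnNge => ltA.
rewrite cardsCs setCK card_ord leq_subLR; apply: leq_trans (leq_add ltA (leqnn _));
  lia.
Qed.

(** * The bound of (c), its sharpness, and the best layer in (b) *)

Lemma disjoint_pairs_boundE n :
  disjoint_pairs_bound n = (2^-1 * (trinomial_max n)%:R)%R.
Proof.
rewrite /disjoint_pairs_bound /trinomial_max natrM mulrA /ceil_divn.
have -> : (2 * n + 3.-1) %/ 3 = n - n %/ 3 by lia.
congr (_ * ('C(_, _))%:R)%R; case: eqP => n3; lia.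
Qed.

Lemma double_disjoint_pairs_bound n b :
  2 * b = trinomial_max n -> b%:R%R = disjoint_pairs_bound n.
Proof.
by move=> eqb; rewrite disjoint_pairs_boundE -eqb natrM mulKf.
Qed.

Lemma trinomial_max_layer n : n %% 3 = 0 \/ n %% 3 = 1 ->
  'C(n, n %/ 3) * 'C(n - n %/ 3, n %/ 3) = trinomial_max n.
Proof. by move=> n3; rewrite /trinomial_max; congr (_ * 'C(_, _)); lia. Qed.

(** Taking the part floor(n/3) last instead of first gives the same trinomial coefficient. *)
Lemma trinomial_max_layer2 n : n %% 3 = 2 ->
  'C(n, ceil_divn n 3) * 'C(n - ceil_divn n 3, ceil_divn n 3) = trinomial_max n.
Proof.
move=> n3; rewrite /trinomial_max /ceil_divn; set q := n %/ 3.
have -> : (n + 3.-1) %/ 3 = q.+1 by rewrite /q; lia.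
have -> : (n - q)./2 = q.+1 by rewrite /q; lia.
have le1 : q.+1 + q.+1 <= n by rewrite /q; lia.
have le2 : q + q.+1 <= n by rewrite /q; lia.
have := bin_bin_fact le2; rewrite -(bin_bin_fact le1).
have -> : n - q.+1 - q.+1 = q by rewrite /q; lia.
have -> : n - q - q.+1 = q.+1 by rewrite /q; lia.
rewrite -[q`! * _ * _]mulnA [q`! * _]mulnC => /esym/eqP.
by rewrite eqn_pmul2r ?muln_gt0 ?fact_gt0 // => /eqP.
Qed.

Lemma beta0_le_max r n (F : {set {set 'I_n}}) : 0 < n -> antichain F ->
  beta0 r F <= n ^ (2 * r + 1) * \max_(l < n.+1) beta0 r (layer n l).
Proof.
move=> n_gt0 acF; set M := \max_(l < n.+1) _.
have leM l : l <= n -> beta0 r (layer n l) <= M.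
  by rewrite -ltnS => ltl; apply: (leq_bigmax (Ordinal ltl)).
have [r_gt2|] := ltnP 2 r; first exact: beta0_ge3.
have pow_gt0 : 0 < n ^ (2 * r + 1) by rewrite expn_gt0 n_gt0.
case: r @M leM pow_gt0 => [|[|[|//]]] M leM pow_gt0 _.
(* The empty subfamily has the full set as its intersection, nonempty since n > 0. *)
- rewrite (_ : beta0 0 F = 0) //; apply/eqP; rewrite cards_eq0; apply/eqP/setP => T.
  rewrite !inE; apply/negP => /and3P[_]; rewrite cards_eq0 => /eqP->.
  by rewrite big_set0 => /eqP/setP/(_ (Ordinal n_gt0)); rewrite !inE.
(* The only candidate is the singleton of the empty set, found in layer 0. *)
- apply: leq_trans (leq_trans (leM 0 _) (leq_pmull _ pow_gt0)) => //.
  apply/subset_leq_card/subsetP => T; rewrite !inE => /and3P[_ /cards1P[B ->]].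
  by rewrite big_set1 => /eqP->; rewrite sub1set inE cards0 cards1 !eqxx.
have [n1|n_gt1] : n = 1 \/ 1 < n by lia.
  by subst n; rewrite beta0E no_tuples.
apply: leq_trans _ (leq_pmull _ pow_gt0).
(* For pairs an extremal layer of (c) attains the bound. *)
have [n3|n3] : (n %% 3 = 0 \/ n %% 3 = 1) \/ n %% 3 = 2 by lia.
  apply: leq_trans (leM (n %/ 3) _); last by lia.
  rewrite -(@leq_pmul2l 2) // beta0_2_layer ?trinomial_max_layer //; last by lia.
  exact: beta0_2_le.
apply: leq_trans (leM (ceil_divn n 3) _); last by rewrite /ceil_divn; lia.
rewrite -(@leq_pmul2l 2) // beta0_2_layer ?trinomial_max_layer2 //.
  exact: beta0_2_le.
by rewrite /ceil_divn; lia.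
Qed.

Theorem theorem1p8 :
  (forall (n : nat) (F : {set {set 'I_n}}), antichain F ->
     [/\ forall r : nat, 3 <= r ->
           gamma0 r F <= n ^ (2 * r) * gamma0 r (layer n n./2),
         ~~ odd n -> gamma0 2 F <= gamma0 2 (layer n n./2)
       & odd n -> gamma0 2 F <= binz n.-1 (n./2%:Z - 1)%R])
  /\
  (forall r : nat, exists l : nat -> nat,
     forall (n : nat) (F : {set {set 'I_n}}), 0 < n -> antichain F ->
       beta0 r F <= n ^ (2 * r + 1) * beta0 r (layer n (l n)))
  /\
  ((forall (n : nat) (F : {set {set 'I_n}}), antichain F ->
      ((beta0 2 F)%:R <= disjoint_pairs_bound n)%R)
   /\
   (forall n : nat, 1 < n -> n %% 3 = 0 \/ n %% 3 = 1 ->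
      antichain (layer n (n %/ 3)) /\
      (beta0 2 (layer n (n %/ 3)))%:R%R = disjoint_pairs_bound n)
   /\
   (forall n : nat, n %% 3 = 2 ->
      antichain (layer n (ceil_divn n 3)) /\
      (beta0 2 (layer n (ceil_divn n 3)))%:R%R = disjoint_pairs_bound n)).
Proof.
(* In these residue classes n > 1 makes floor(n/3) positive. *)
have sharp01 n : 1 < n -> n %% 3 = 0 \/ n %% 3 = 1 ->
    2 * beta0 2 (layer n (n %/ 3)) = trinomial_max n.
  by move=> n_gt1 n3; rewrite beta0_2_layer ?trinomial_max_layer //; lia.
have sharp2 n : n %% 3 = 2 ->
    2 * beta0 2 (layer n (ceil_divn n 3)) = trinomial_max n.
  by move=> n3; rewrite beta0_2_layer ?trinomial_max_layer2 // /ceil_divn; lia.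
split; [|split; [|split; [|split]]].
- move=> n F acF; split=> [r r_ge3|evenn|oddn].
  + exact: gamma0_ge3.
  + exact: gamma0_2_even.
  exact: gamma0_2_odd.
- move=> r; have ord_gt0 n : 0 < #|'I_n.+1| by rewrite card_ord.
  (* A layer with the most tuples, chosen from r and n before the family is given. *)
  pose best n := @bigop.eq_bigmax _ (fun l : 'I_n.+1 => beta0 r (layer n l))
    (ord_gt0 n).
  exists (fun n => nat_of_ord (sval (best n))) => n F n_gt0 acF.
  by rewrite -(svalP (best n)); apply: beta0_le_max.
- move=> n F acF; rewrite disjoint_pairs_boundE ler_pdivlMl // -natrM ler_nat.
  exact: beta0_2_le.
- move=> n n_gt1 n3; split; first exact: antichain_layer.
  exact/double_disjoint_pairs_bound/sharp01.
move=> n n3; split; first exact: antichain_layer.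
exact/double_disjoint_pairs_bound/sharp2.
Qed.
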